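(* Let $f:\mathbb{R}^n\times\mathbb{R}^n\to\mathbb{R}$ be a function, $C$ be a non-empty, convex and closed subset of $\mathbb{R}^n$, and $K:C\rightrightarrows C$ be a set-valued map. Suppose that the quasi-equilibrium problem associated to $f$ and $K$ satisfies the uniform coerciveness condition (UCC) with coercive radius $\rho>0$, and that the following properties hold: \begin{itemize} \item the map $K$ is lower semi-continuous with convex and non-empty values; \item the set $\mathrm{Fix}(K)$ is closed; \item for each $x\in\mathrm{Fix}(K)$ and all $y,z\in\mathbb{R}^n$, the following implication holds: \[ \bigl(f(x,y)\leq 0 \text{ and } f(x,z)<0\bigr)\Rightarrow f(x,ty+(1-t)z)<0 \text{ for all } t\in\,]0,1[. \] \end{itemize} Then the set $\mathrm{QEP}(f,K)$ is non-empty provided that one of the following assumptions holds: \begin{enumerate} \item $f$ is properly quasi-monotone on $C$ and has the upper sign property on $C$, and the set-valued map $G:\mathrm{Fix}(K)\rightrightarrows C$ defined by \[ G(x):=\{y\in K(x)\cap\overline{B}_\rho:\ f(y,x)>0\} \] is lower semi-continuous; \item $f(x,x)\geq 0$ for all $x\in\mathrm{Fix}(K)$, and the set-valued map $R:\mathrm{Fix}(K)\rightrightarrows C$ defined by \[ R(x):=\{y\in K(x):\ f(x,y)<0\} \] is lower semi-continuous with convex values. \end{enumerate}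
   Context: $B_\rho$ and $\overline{B}_\rho$ denote the open and closed balls in $\mathbb{R}^n$ with centre $0$ and radius $\rho$. Set-valued maps may take empty values unless stated otherwise. For $K:C\rightrightarrows C$, $\mathrm{Fix}(K):=\{x\in C: x\in K(x)\}$, and $\mathrm{QEP}(f,K)$ is the set of all $x_0\in C$ such that $x_0\in K(x_0)$ and $f(x_0,y)\geq 0$ for all $y\in K(x_0)$. Uniform coerciveness condition (UCC): the quasi-equilibrium problem associated to $f$ and $K$ satisfies the UCC with coercive radius $\rho>0$ if (i) $K(w)\cap B_\rho\neq\emptyset$ for all $w\in C$; and (ii) for each $z\in\mathrm{Fix}(K)$ there exists $\rho_z\in\,]0,\rho[$ such that for every $x\in (K(z)\cap\overline{B}_\rho)\setminus\overline{B}_{\rho_z}$ there exists $y\in K(z)$ with $\|y\|<\|x\|$ and $f(x,y)\leq 0$. A set-valued map $T:X\rightrightarrows Y$ between topological spaces is lower semi-continuous at $x_0$ if for each open set $V\subset Y$ with $T(x_0)\cap V\neq\emptyset$ there is a neighbourhood $U$ of $x_0$ such that $T(x)\cap V\neq\emptyset$ for all $x\in U$; it is lower semi-continuous if this holds at every point of $X$. Subsets of $\mathbb{R}^n$ carry the subspace topology. $f$ is properly quasi-monotone on a convex set $C$ if for all $x_1,\dots,x_m\in C$ and all $x$ in the convex hull of $\{x_1,\dots,x_m\}$ one has $\min_{i=1,\dots,m} f(x_i,x)\leq 0$. $f$ has the upper sign property on $C$ if for all $x,y\in C$: whenever $f(x_t,x)\leq 0$ for all $t\in\,]0,1[$, where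 $x_t:=tx+(1-t)y$, then $f(x,y)\geq 0$. *)

(* Defs.v *)
From HB Require Import structures.
From mathcomp Require Import all_boot all_order all_algebra.
From mathcomp Require Import all_classical all_reals all_analysis.

Set Implicit Arguments.
Unset Strict Implicit.
Unset Printing Implicit Defensive.

Import Order.TTheory GRing.Theory Num.Theory.
Import numFieldNormedType.Exports.

Local Open Scope classical_set_scope.
Local Open Scope ring_scope.

(* The library norm `|x| on 'rV[R]_n is the sup norm.  It induces the usual
   topology, but balls and comparisons of norms need the Euclidean norm. *)
Definition enorm (R : realType) (n : nat) (x : 'rV[R]_n) : R :=
  Num.sqrt (\sum_(i < n) x 0 i ^+ 2).

Definition oball {R : realType} {n : nat} (rho : R) : set 'rV[R]_n :=
  [set x | enorm x < rho].

Definition cball {R : realType} {n : nat} (rho : R) : set 'rV[R]_n :=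
  [set x | enorm x <= rho].

(* A set-valued map X ~> Y with X, Y subsets of R^n is a total function
   T : 'rV[R]_n -> set 'rV[R]_n considered only at the points of X, with
   T x `<=` Y for x in X.  Lower semi-continuity on X is obtained by giving
   the source the type [subspace X]: at x0 in X the neighbourhoods are those of
   the subspace topology, while at x0 outside X the filter is principal and
   the condition is void.  As the values lie in Y, testing them against open
   sets of R^n or against open sets of Y is the same. *)
Definition lsc_setmap (X Y : topologicalType) (T : X -> set Y) : Prop :=
  forall (x0 : X) (V : set Y), open V -> T x0 `&` V !=set0 ->
    \forall x \near x0, T x `&` V !=set0.

Definition Fix (R : realType) (n : nat) (C : set 'rV[R]_n)
    (K : 'rV[R]_n -> set 'rV[R]_n) : set 'rV[R]_n :=
  [set x | C x /\ K x x].

Definition QEP (R : realType) (n : nat) (f : 'rV[R]_n -> 'rV[R]_n -> R)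
    (C : set 'rV[R]_n) (K : 'rV[R]_n -> set 'rV[R]_n) : set 'rV[R]_n :=
  [set x0 | [/\ C x0, K x0 x0 & forall y, K x0 y -> 0 <= f x0 y]].

Definition UCC (R : realType) (n : nat) (f : 'rV[R]_n -> 'rV[R]_n -> R)
    (C : set 'rV[R]_n) (K : 'rV[R]_n -> set 'rV[R]_n) (rho : R) : Prop :=
  (forall w, C w -> K w `&` oball rho !=set0) /\
  (forall z, Fix C K z -> exists2 rho_z : R, 0 < rho_z < rho &
    forall x, ((K z `&` cball rho) `\` cball rho_z) x ->
      exists y, [/\ K z y, enorm y < enorm x & f x y <= 0]).

Definition convex_hull (R : realType) (n : nat) (A : set 'rV[R]_n) :
  set 'rV[R]_n := smallest (@convex_set R 'rV[R]_n) A.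

(* The families are x_0, ..., x_m, hence nonempty; [f (x ord0) y] as initial
   value of the iterated minimum is one of its terms. *)
Definition properly_quasimonotone (R : realType) (n : nat)
    (f : 'rV[R]_n -> 'rV[R]_n -> R) (C : set 'rV[R]_n) : Prop :=
  forall (m : nat) (x : 'I_m.+1 -> 'rV[R]_n), (forall i, C (x i)) ->
  forall y, convex_hull (range x) y ->
    \big[Num.min/f (x ord0) y]_(i < m.+1) f (x i) y <= 0.

Definition upper_sign_property (R : realType) (n : nat)
    (f : 'rV[R]_n -> 'rV[R]_n -> R) (C : set 'rV[R]_n) : Prop :=
  forall x y, C x -> C y ->
    (forall t : R, 0 < t < 1 -> f (t *: x + (1 - t) *: y) x <= 0) ->
    0 <= f x y.

Definition Gmap (R : realType) (n : nat) (f : 'rV[R]_n -> 'rV[R]_n -> R)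
    (K : 'rV[R]_n -> set 'rV[R]_n) (rho : R) (x : 'rV[R]_n) : set 'rV[R]_n :=
  [set y | (K x `&` cball rho) y /\ 0 < f y x].

Definition Rmap (R : realType) (n : nat) (f : 'rV[R]_n -> 'rV[R]_n -> R)
    (K : 'rV[R]_n -> set 'rV[R]_n) (x : 'rV[R]_n) : set 'rV[R]_n :=
  [set y | K x y /\ f x y < 0].

(* Main.v *)
Require Import Defs.
From HB Require Import structures.
From mathcomp Require Import all_boot all_order all_algebra.
From mathcomp Require Import all_classical all_reals all_analysis.
From mathcomp Require Import ring lra.
Set Implicit Arguments.
Unset Strict Implicit.
Unset Printing Implicit Defensive.
Import Order.TTheory GRing.Theory Num.Theory.
Import numFieldNormedType.Exports.

(** Both alternatives are reduced to a fixed point theorem for lower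
semi-continuous maps with convex, not necessarily closed, values
([lsc_fixed_point]).  Let [D] be the part of [C] in the closed ball of radius
[rho].  If QEP(f, K) were empty, a map [T] on [D] built from the points that
violate the equilibrium inequality on Fix(K), and from [K] elsewhere, would be
lower semi-continuous with nonempty convex values contained in those of [K].  A
point [x] of [T x] cannot lie outside Fix(K), where it would belong to [K x];
and if it lies in Fix(K), the choice of [T x] gives a contradiction.

In the first alternative [T x] is the convex hull of [G x] on Fix(K), so that
[x] in [T x] contradicts proper quasi-monotonicity; when [G x] is empty, the
upper sign property makes [f x] nonnegative on the part of [K x] in the closed
ball.  In the second one [T x] is contained in [R x] on Fix(K), and [x] in [R x]
means [f x x < 0].  In both, the coercivity condition and the convexity
property of [f x] turn a negative value of [f x] on [K x] into a negative value
inside the open ball ([negative_in_oball]).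

The fixed point theorem combines Michael's selection theorem for convex values
in [R^n] ([michael_selection]) with Brouwer's theorem
([brouwer_compact_convex]), applied to a selection of [T] followed by the
metric projection onto [D].  The projection leaves the values of the selection
in place when they are in the ball; otherwise it sends them to the sphere of
radius [rho], where [T] is required to take its values in the ball.

Brouwer's theorem is derived from Scarf's combinatorial lemma ([scarf]), which
replaces Sperner's lemma and needs no triangulation: it is applied to the grid
points of a simplex, ordered by each of their coordinates ([scarf_grid]).

For the selection theorem, selections of the closure of [T] are obtained as
uniform limits of approximate ones ([closed_selection]); countably many of them
take values dense in [T x] for every [x] ([dense_selections]).  The mean of
these with weights [2^-(m+1)] lies in [T x] itself: a functional separating
it properly from [T x] would be nonnegative at the translated selections,
positive at one of them, and yet have mean zero ([geometric_mean_mem]). *)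

(** * Scarf's lemma *)

Section Scarf.
Import mathcomp.boot.fintype mathcomp.boot.finset.
Variables (I Z : finType) (s : I -> Z) (r : I -> Z -> nat) (c : Z -> I).

(** [Z] is a finite set with one total order for each [i] in [I], given by the
injective rank function [r i].  The slack element [s i] is the least one for
the order [i] and, for the other orders, is above all elements that are not
slack.  The map [c] colours [Z], the slack element [s i] having colour [i].
A set is dominant if no element of [Z] is strictly above the minimum of
the set for all orders at once. *)
Definition dominant (S : {set Z}) :=
  [forall y, [exists i, [forall x in S, r i y <= r i x]]].

(** A dominant set with as many elements as there are orders; rooms play the
part of the maximal cells of a triangulation. *)
Definition room (S : {set Z}) := (#|S| == #|I|) && dominant S.

Hypothesis r_inj : forall i, injective (r i).
Hypothesis s_min : forall i z, r i (s i) <= r i z.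
Hypothesis s_max : forall i j z, j != i -> z \notin codom s -> r j z < r j (s i).
Hypothesis cK : cancel s c.

Lemma dominantP (S : {set Z}) :
  reflect (forall y, exists i, forall x, x \in S -> r i y <= r i x)
          (dominant S).
Proof.
apply: (iffP forallP) => H y.
  have /existsP[i /forall_inP Hi] := H y; by exists i.
by have [i Hi] := H y; apply/existsP; exists i; apply/forall_inP.
Qed.

Lemma dominantS (S S' : {set Z}) : S \subset S' -> dominant S' -> dominant S.
Proof.
move=> /subsetP sub /dominantP H; apply/dominantP => y.
by have [i Hi] := H y; exists i => x /sub /Hi.
Qed.

Variable i0 : I.

(** A possible facet of a room, carrying all colours but [i0] exactly once. *)
Definition door (t : {set Z}) := (#|t|.+1 == #|I|) && (c @: t == ~: [set i0]).

(** Deleting [z] from [S] leaves all colours but [i0] only if [z] is one of the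
two elements of the repeated colour. *)
Lemma even_doors_of_room (S : {set Z}) : #|S| = #|I| -> c @: S != [set: I] ->
  ~~ odd #|[set z in S | door (S :\ z)]|.
Proof.
move=> cS nfull; have [->|[z]] := set_0Vmem [set z in S | door (S :\ z)].
  by rewrite cards0.
rewrite inE /door => /andP[zS /andP[/eqP cSz /eqP cz]].
have cardS w : w \in S -> #|S :\ w|.+1 = #|I|.
  by move=> wS; rewrite -cS (cardsD1 w S) wS.
have inj : {in S :\ z &, injective c}.
  by apply/imset_injP; rewrite cz cardsC1 -(cardS z zS).
have czi0 : c z != i0.
  apply: contra nfull => /eqP ci0; rewrite -(setD1K zS) imsetU1 cz ci0.
  by rewrite -setTD setD1K.
have /imsetP[z' z'S cz'] : c z \in c @: (S :\ z) by rewrite cz !inE.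
have [z'z z'S'] : z' != z /\ z' \in S by move: z'S; rewrite !inE => /andP[].
suff -> : [set w in S | door (S :\ w)] = [set z; z'].
  by rewrite cards2 eq_sym z'z.
apply/setP => w; rewrite !inE; apply/idP/idP; last first.
  case/orP => /eqP->; first by rewrite zS /door cSz cz !eqxx.
  rewrite z'S' /door (cardS _ z'S') eqxx /= -cz.
  apply/eqP/setP => i; apply/imsetP/imsetP => -[u]; rewrite !inE => /andP[u1 u2] ->.
    have [->|uz] := eqVneq u z; first by exists z'.
    by exists u; rewrite // !inE uz.
  have [->|uz'] := eqVneq u z'; first by exists z; rewrite // !inE eq_sym z'z.
  by exists u; rewrite // !inE uz'.
case/andP => wS /andP[_ /eqP cw]; apply: contraT.
rewrite negb_or => /andP[wz wz'].
have wSz : w \in S :\ z by rewrite !inE wz.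
have cwz : c w != c z.
  by apply: contra wz'; rewrite cz' => /eqP/inj-> //.
have : c w \in c @: (S :\ w) by rewrite cw -cz; apply/imsetP; exists w.
case/imsetP => u; rewrite !inE => /andP[uw uS] cwu.
have uz : u != z by apply: contra cwz => /eqP<-; rewrite cwu.
have /inj : w \in S :\ z by [].
move=> /(_ u); rewrite !inE uz uS => /(_ isT cwu) e.
by rewrite e eqxx in uw.
Qed.

(** For a dominant [t] with one element less than there are orders, the map
sending an order to the minimum of [t] is onto [t], so exactly two orders [i]
and [j] share their minimum.  A room containing [t] is obtained by adding the
[k]-greatest element that exceeds the minima of [t] for all orders but [k], with
[k = i] or [k = j]. *)
Lemma even_rooms_of_door (t : {set Z}) x0 : x0 \in t -> x0 \notin codom s ->
  #|t|.+1 = #|I| -> ~~ odd #|[set z | (z \notin t) && room (z |: t)]|.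
Proof.
move=> x0t x0s ct.
have [->|[z]] := set_0Vmem [set z | (z \notin t) && room (z |: t)].
  by rewrite cards0.
rewrite inE => /andP[_ /andP[_ /(dominantS (subsetUr _ _)) domt]] {z}.
(* [mn i] is the minimum of [t] for the order [i]. *)
pose mn i := [arg min_(z < x0 in t) r i z].
have mnt i : mn i \in t by rewrite /mn; case: arg_minnP.
have mn_le i x : x \in t -> r i (mn i) <= r i x.
  by rewrite /mn; case: arg_minnP => // k kt H /H.
have mn_surj (L : {set I}) : (forall x, x \in t -> exists2 i, i \in L & mn i = x) ->
    mn @: L = t.
  move=> H; apply/setP => x; apply/imsetP/idP => [[i _ ->]//|/H[i iL <-]].
  by exists i.
have mnT : mn @: [set: I] = t.
  apply: mn_surj => x xt; have /dominantP/(_ x)[i Hi] := domt.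
  exists i => //; apply: (r_inj (i := i)); apply/eqP.
  by rewrite eqn_leq mn_le //= Hi.
have [i [j [ij mij]]] : exists i j, i != j /\ mn i = mn j.
  have : ~~ injectiveb mn.
    apply/injectiveP => inj; have := card_imset [set: I] inj.
    by rewrite mnT cardsT -ct => /eqP; rewrite eqn_leq ltnn andbF.
  by move/injectivePn => [i [j ij e]]; exists i, j.
have mnD (k k' : I) : k != k' -> mn k = mn k' -> mn @: (~: [set k]) = t.
  move=> kk' e; apply: mn_surj => x; rewrite -{1}mnT => /imsetP[l _ ->].
  have [->|lk] := eqVneq l k; first by exists k'; rewrite ?inE 1?eq_sym.
  by exists l; rewrite ?inE.
have mnI k (L : {set I}) : mn @: L = t -> k \notin L -> L = ~: [set k].
  move=> e kL; apply/eqP; rewrite eqEcard; apply/andP; split.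
    by apply/subsetP => l lL; rewrite !inE; apply: contra kL => /eqP<-.
  by rewrite cardsC1 -ct /= -e leq_imset_card.
have mn_inj k : mn @: (~: [set k]) = t -> {in ~: [set k] &, injective mn}.
  by move=> e; apply/imset_injP; rewrite e cardsC1 -ct.
pose M k := [pred y | [forall (l | l != k), r l (mn l) < r l y]].
have MP k y : reflect (forall l, l != k -> r l (mn l) < r l y) (M k y).
  exact: forall_inP.
have sM k k' : k != k' -> mn k = mn k' -> M k (s k).
  move=> kk' e; apply/MP => l lk.
  by apply: leq_ltn_trans (mn_le l x0 x0t) (s_max lk x0s).
pose w k := [arg max_(y > s k | M k y) r k y].
have wP k k' : k != k' -> mn k = mn k' ->
    M k (w k) /\ (forall y, M k y -> r k y <= r k (w k)).
  by move=> kk' e; rewrite /w; case: arg_maxnP => //; apply: sM e.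
have domP y : exists l, r l y <= r l (mn l).
  by have /dominantP/(_ y)[l Hl] := domt; exists l; exact: Hl.
have wt k k' : k != k' -> mn k = mn k' -> w k \notin t.
  move=> kk' e; have [/MP wM _] := wP _ _ kk' e.
  apply/negP; rewrite -(mnD _ _ kk' e) => /imsetP[l]; rewrite !inE => lk wl.
  by have := wM l lk; rewrite wl ltnn.
have wroom k k' : k != k' -> mn k = mn k' -> room (w k |: t).
  move=> kk' e; have [/MP wM wmax] := wP _ _ kk' e.
  rewrite /room cardsU1 (wt _ _ kk' e) add1n ct eqxx /=.
  apply/dominantP => y.
  have [/MP yM|] := boolP (M k y).
    exists k => x; rewrite !inE => /orP[/eqP->|xt]; first by apply: wmax; apply/MP.
    have [l Hl] := domP y.
    have [elk|lk] := eqVneq l k; last by have := yM l lk; rewrite ltnNge Hl.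
    by rewrite -elk; apply: leq_trans Hl (mn_le _ _ xt).
  rewrite negb_forall_in => /existsP[l /andP[lk]]; rewrite -leqNgt => Hl.
  exists l => x; rewrite !inE => /orP[/eqP->|xt].
    by apply: leq_trans Hl (ltnW (wM _ lk)).
  by apply: leq_trans Hl (mn_le _ _ xt).
have wij : w i != w j.
  have [/MP wiM _] := wP _ _ ij mij.
  have [/MP wjM _] : M j (w j) /\ (forall y, M j y -> r j y <= r j (w j)).
    by apply: (wP j i); rewrite 1?eq_sym.
  apply/eqP => e; have [l Hl] := domP (w i).
  have [li|li] := eqVneq l i; last by have := wiM l li; rewrite ltnNge Hl.
  have := wjM l; rewrite -e ltnNge Hl li => /(_ ij); by [].
suff -> : [set z | (z \notin t) && room (z |: t)] = [set w i; w j].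
  by rewrite cards2 wij.
apply/setP => z; rewrite !inE; apply/idP/idP; last first.
  case/orP => /eqP->; first by rewrite (wt _ _ ij mij) (wroom _ _ ij mij).
  by rewrite (wt j i) ?(wroom j i) // eq_sym.
case/andP => zt /andP[_ /dominantP domz].
have [l Hl] := domz z.
have zl : r l z < r l (mn l).
  rewrite ltn_neqAle Hl ?inE ?mnt ?orbT // andbT.
  by apply: contra zt => /eqP/r_inj->.
pose L := [set l' | r l' (mn l') < r l' z].
have mnL : mn @: L = t.
  apply: mn_surj => x xt; have [l' Hl'] := domz x.
  have e : mn l' = x.
    apply: (r_inj (i := l')); apply/eqP.
    by rewrite eqn_leq mn_le //= Hl' // !inE mnt orbT.
  exists l' => //; rewrite inE e ltn_neqAle Hl' ?inE ?eqxx // andbT.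
  by apply: contra zt => /eqP/r_inj<-.
have lL : l \notin L by rewrite inE -leqNgt ltnW.
have eL := mnI _ _ mnL lL.
have lij : (l == i) || (l == j).
  rewrite eL in mnL; apply: contraT; rewrite negb_or => /andP[li lj].
  by have := mn_inj _ mnL i j; rewrite !inE ![_ == l]eq_sym li lj => /(_ isT isT mij)
    /eqP; rewrite (negPf ij).
have zM : M l z by apply/MP => l' l'l; have : l' \in L by [rewrite eL !inE]; rewrite inE.
suff zw k : k != l -> mn k = mn l -> z = w l.
  case/orP: lij zw => /eqP -> zw.
    by rewrite (zw j) ?eqxx // eq_sym.
  by rewrite (zw i) ?eqxx ?orbT // eq_sym.
move=> kl e; have lk : l != k by rewrite eq_sym.
have [/MP wM wmax] := wP l k lk (esym e).
apply: (r_inj (i := l)); apply/eqP; rewrite eqn_leq wmax //= leqNgt; apply/negP => lt.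
have [l' Hl'] := domz (w l).
have [e'|l'l] := eqVneq l' l.
  by have := Hl' z; rewrite !inE eqxx e' leqNgt lt => /(_ isT).
have := wM l' l'l; rewrite ltnNge; apply/negP; rewrite negbK.
by apply: Hl'; rewrite !inE mnt orbT.
Qed.

(** The only door made of slack elements. *)
Let t0 := s @: (~: [set i0]).

(** The element to add is the [i0]-greatest of those that are not slack. *)
Lemma rooms_of_slack_door y0 : y0 \notin codom s ->
  #|[set z | (z \notin t0) && room (z |: t0)]| = 1.
Proof.
move=> y0s; pose y := [arg max_(z > y0 | z \notin codom s) r i0 z].
have [ys ymax] : y \notin codom s /\ forall z, z \notin codom s -> r i0 z <= r i0 y.
  by rewrite /y; case: arg_maxnP.
have t0s z : z \in t0 -> z \in codom s by move=> /imsetP[i _ ->]; exact: codom_f.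
have ct0 : #|t0|.+1 = #|I|.
  rewrite card_imset; last exact: can_inj cK.
  by rewrite cardsC1 prednK //; apply/card_gt0P; exists i0.
suff -> : [set z | (z \notin t0) && room (z |: t0)] = [set y] by rewrite cards1.
apply/setP => z; rewrite !inE; apply/idP/eqP => [|->]; last first.
  have yt0 : y \notin t0 by apply: contra ys; apply: t0s.
  rewrite yt0 /room cardsU1 yt0 add1n ct0 eqxx /=; apply/dominantP => v.
  have [/codomP[j ->]|vs] := boolP (v \in codom s); first by exists j => x _.
  exists i0 => x; rewrite !inE => /orP[/eqP->|/imsetP[j]]; first exact: ymax.
  by rewrite !inE => ji0 ->; rewrite ltnW // s_max // eq_sym.
case/andP => zt /andP[_ /dominantP domz].
have [i Hi] := domz y.
have ii0 : i = i0.
  apply/eqP; apply: contraT => ni; have := Hi (s i).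
  rewrite !inE (_ : s i \in t0) ?orbT; last by apply: imset_f; rewrite !inE.
  move=> /(_ isT) le; case/negP: ys; suff -> : y = s i by exact: codom_f.
  by apply: (r_inj (i := i)); apply/eqP; rewrite eqn_leq le s_min.
subst i; have zs : z \notin codom s.
  apply/negP => /codomP[j ej]; case/negP: ys.
  have ej0 : j = i0.
    apply/eqP; apply: contraT => ni; case/negP: zt; rewrite ej.
    by apply: imset_f; rewrite !inE.
  suff -> : y = s i0 by exact: codom_f.
  apply: (r_inj (i := i0)); apply/eqP; rewrite eqn_leq s_min andbT.
  by apply: Hi; rewrite !inE ej ej0 eqxx.
apply: (r_inj (i := i0)); apply/eqP; rewrite eqn_leq ymax //=.
by apply: Hi; rewrite !inE eqxx.
Qed.

(** Scarf's lemma.  If no room had all colours, each room would have an even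
number of doors, while the doors lie in an even number of rooms, except for
[t0], which lies in one: count the incident pairs modulo 2. *)
Theorem scarf y0 : y0 \notin codom s ->
  exists2 S, room S & c @: S = [set: I].
Proof.
move=> y0s.
have t0s : door t0.
  rewrite /door card_imset; last exact: can_inj cK.
  rewrite cardsC1 prednK ?eqxx /=; last by apply/card_gt0P; exists i0.
  rewrite -imset_comp; apply/eqP/setP => i; apply/imsetP/idP.
    by move=> [j jC ->] /=; rewrite cK.
  by exists i => //=; rewrite cK.
have even_sum (P : pred {set Z}) (F : {set Z} -> nat) :
    (forall S, P S -> ~~ odd (F S)) -> ~~ odd (\sum_(S | P S) F S).
  move=> H; elim/big_ind: _ => // a b; rewrite oddD.
  by move=> /negPf-> /negPf->.
have [/exists_inP[S Sr /eqP cS]|] := boolP [exists S in room, c @: S == [set: I]].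
  by exists S.
rewrite negb_exists_in => /forall_inP nofull; exfalso.
have e : \sum_(S | room S) #|[set z in S | door (S :\ z)]| =
   \sum_(t | door t) #|[set z | (z \notin t) && room (z |: t)]|.
  transitivity (\sum_(S | room S) \sum_(z | (z \in S) && door (S :\ z)) 1).
    by apply: eq_bigr => S _; rewrite sum1dep_card.
  transitivity (\sum_(t | door t) \sum_(z | (z \notin t) && room (z |: t)) 1);
    last by apply: eq_bigr => S _; rewrite sum1dep_card.
  rewrite !pair_big_dep /=.
  rewrite (reindex_onto (fun p : {set Z} * Z => (p.2 |: p.1, p.2))
     (fun p : {set Z} * Z => (p.1 :\ p.2, p.2))) /=; last first.
    by move=> [S z] /= /andP[_ /andP[zS _]]; rewrite setD1K.
  apply: eq_bigl => -[t z] /=; rewrite !inE eqxx /= xpair_eqE eqxx andbT.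
  have [zt|zt] := boolP (z \in t).
    rewrite andbF; apply/negP => /andP[_ /eqP e].
    by move: zt; rewrite -e !inE eqxx.
  by rewrite setU1K // eqxx andbT andbC.
have := even_sum _ _ (fun S (h : room S) =>
  even_doors_of_room (eqP (proj1 (andP h))) (nofull S h)).
rewrite e (bigD1 t0) //= (rooms_of_slack_door y0s) oddD /= negbK.
apply/negP; apply: even_sum => t /andP[/andP[/eqP ct /eqP cc] tt0].
have [/subsetP ts|/subsetPn[x xt xs]] := boolP (t \subset codom s); last first.
  exact: even_rooms_of_door xt xs ct.
case/eqP: tt0; apply/setP => z; rewrite /t0 -cc.
apply/idP/imsetP => [zt|[_ /imsetP[x xt ->] ->]].
  by have /codomP[i ei] := ts _ zt; exists i => //; apply/imsetP; exists z; rewrite // ei cK.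
by have /codomP[i ei] := ts _ xt; rewrite ei cK -ei.
Qed.

End Scarf.

Section Grid.
Import mathcomp.boot.fintype mathcomp.boot.finset.
Variables (n N : nat).
Let I := 'I_n.+1.

(** The points of a simplex with [n.+1] barycentric coordinates in [1/N]-steps,
scaled by [N]. *)
Definition gridb (x : {ffun I -> 'I_N.+1}) := (\sum_i x i == N).
Definition grid := {x : {ffun I -> 'I_N.+1} | gridb x}.

Lemma gridP (a : I -> nat) : (\sum_i a i = N) ->
  exists x : grid, forall i, (val x i : nat) = a i.
Proof.
move=> aN; have al i : (a i < N.+1) by rewrite ltnS -aN (bigD1 i) //= leq_addr.
have H : gridb [ffun i => Ordinal (al i)].
  by rewrite /gridb -[X in _ == X]aN; apply/eqP/eq_bigr => i _; rewrite ffunE.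
by exists (Sub _ H) => i; rewrite SubK ffunE.
Qed.

Lemma grid_sum (x : grid) : (\sum_i (val x i : nat) = N).
Proof. exact/eqP/(valP x). Qed.

(** For a colouring of the grid there is a point [x0] such that every colour
occurs near [x0], or else the corresponding coordinate of [x0] is small.  As no
grid point exceeds the minima of a dominant set in all the coordinates concerned,
these minima add up to nearly [N], which leaves little room for the points of
the set to differ. *)
Lemma scarf_grid (c : grid -> I) : exists x0 : grid, forall i,
  (exists2 x, c x = i & forall j, (val x j <= val x0 j + n.+1) /\
                                  (val x0 j <= val x j + n.+1))
  \/ (val x0 i <= n.+1).
Proof.
have [g0 _] : exists x : grid, forall i, (val x i : nat) = (if i == ord0 then N else 0).
  by apply: gridP; rewrite -big_mkcond big_pred1_eq.
pose Z := (grid + I)%type.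
pose G := #|{: grid}|.
(* Ties between equal coordinates are broken by the rank in the enumeration. *)
pose r (i : I) (z : Z) : nat := match z with
  | inl x => (val x i * G + enum_rank x).+1
  | inr j => if j == i then 0 else ((N.+1 * G).+1 + j) end.
pose c' (z : Z) := match z with inl x => c x | inr i => i end.
have r_le i (x : grid) : (val x i * G + enum_rank x < N.+1 * G).
  rewrite (@leq_trans (val x i * G + G)) ?ltn_add2l ?ltn_ord //.
  by rewrite addnC -mulSn leq_mul2r ltn_ord orbT.
have r_inj i : injective (r i).
  move=> [x|j] [y|k] /=.
  - move=> [e]; congr inl; apply: enum_rank_inj; apply: val_inj => /=.
    have := congr1 (modn^~ G) e; rewrite !modnMDl !modn_small //; exact: ltn_ord.
  - case: eqP => // _ [e]; have := r_le i x; rewrite e.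
    by rewrite ltnNge leq_addr.
  - case: eqP => // _ [e]; have := r_le i y; rewrite -e.
    by rewrite ltnNge leq_addr.
  - case: eqP => [->|_]; case: eqP => [->|_] // /eqP.
    by rewrite eqn_add2l => /eqP/val_inj->.
have codom_inl x : inl x \notin codom (inr : I -> Z) by apply/codomP => -[].
have [|||S /andP[/eqP cS /dominantP domS] fullS] :=
    @scarf I Z inr r c' r_inj _ _ _ ord0 (inl g0) (codom_inl _).
- by move=> i z; rewrite /= eqxx.
- move=> i j [x|k] ji; last by rewrite codom_f.
  by move=> _ /=; rewrite eq_sym (negPf ji) addSn ltnS (leq_trans (r_le _ _)) // leq_addr.
- by [].
(* [C] consists of the orders whose slack element is not in the room [S]. *)
pose C := [set i : I | inr i \notin S].
have domC i (x : grid) : (forall z, z \in S -> (r i (inl x) <= r i z)) -> i \in C.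
  by move=> H; rewrite inE; apply/negP => /H; rewrite /= eqxx.
have [i1 i1C] : exists i, i \in C.
  by have [i /domC iC] := domS (inl g0); exists i.
have [x0 x0S] : exists x0, inl x0 \in S.
  apply/existsP; apply: contraT; rewrite negb_exists => /forallP nx.
  move: i1C; rewrite inE => /negP; case.
  have /subset_cardP : #|S| = #|[set inr i | i in [set: I]] : {set Z}|.
    by rewrite cS card_imset ?cardsT // => ? ? [].
  move=> /elimT eS; rewrite eS; first by apply/imsetP; exists i1.
  by apply/subsetP => -[x xS|i _]; [case/negP: (nx x)|apply/imsetP; exists i].
pose mn i := [arg min_(x < x0 | inl x \in S) (val x i : nat)].
have mnS i : inl (mn i) \in S by rewrite /mn; case: arg_minnP.
have mn_le i x : inl x \in S -> (val (mn i) i <= val x i).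
  by rewrite /mn; case: arg_minnP => // k kt H /H.
pose m i : nat := val (mn i) i.
(* Otherwise the grid point with coordinates above all minima, the surplus being
   put on [i1], would contradict dominance. *)
have key : (N < \sum_(i in C) (m i).+1).
  rewrite ltnNge; apply/negP => le.
  pose a i := ((if i \in C then (m i).+1 else 0) +
     (if i == i1 then N - \sum_(i in C) (m i).+1 else 0)).
  have [|y yE] := gridP (a := a).
    by rewrite big_split /= -!big_mkcond /= big_pred1_eq subnKC.
  have [i Hi] := domS (inl y); have iC := domC i y Hi.
  have := Hi _ (mnS i); rewrite /r /= ltnS leqNgt; apply/negP; rewrite negbK.
  rewrite (@leq_trans (val y i * G)) ?leq_addr // yE /a iC.
  rewrite (@leq_trans ((m i).+1 * G)) //; last by rewrite leq_mul2r leq_addr orbT.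
  by rewrite mulSn addnC ltn_add2r ltn_ord.
have cC : (#|C| <= n.+1) by have := max_card (mem C); rewrite card_ord.
have split_sum x : inl x \in S -> forall i, i \in C -> (val x i <= m i + n.+1).
  move=> xS i iC; have := grid_sum x; rewrite (bigID (mem C)) /= => e.
  have : (\sum_(j in C) val x j < \sum_(j in C) (m j).+1).
    by apply: leq_ltn_trans key; rewrite -[leqRHS]e leq_addr.
  rewrite [ltnRHS](eq_bigr (fun j => m j + 1)); last by move=> j _; rewrite addn1.
  rewrite big_split /= sum1_card !(bigD1 i iC) /= => lt.
  have le : (\sum_(j in C | j != i) m j <= \sum_(j in C | j != i) val x j).
    by apply: leq_sum => j _; exact: mn_le.
  have lt' : (val x i + \sum_(j in C | j != i) m j < m i + n.+1 + \sum_(j in C | j != i) m j).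
    apply: leq_ltn_trans (leq_add (leqnn _) le) _; apply: leq_trans lt _.
    by rewrite -addnA [(\sum_(j in C | _) _ + _)]addnC addnA leq_add2r leq_add2l.
  by move: lt'; rewrite ltn_add2r => /ltnW.
have out_sum x : inl x \in S -> forall i, i \notin C -> (val x i <= n.+1).
  move=> xS i iC; have := grid_sum x; rewrite (bigID (mem C)) /= => e.
  have le : (\sum_(j in C) m j <= \sum_(j in C) val x j).
    by apply: leq_sum => j _; exact: mn_le.
  have : (\sum_(j in C) m j + val x i < \sum_(j in C) m j + n.+1).
    apply: (@leq_ltn_trans N).
      by rewrite -[leqRHS]e leq_add // (bigD1 i) //= leq_addr.
    apply: leq_trans key _.
    rewrite [leqLHS](eq_bigr (fun j => m j + 1)); last by move=> j _; rewrite addn1.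
    by rewrite big_split /= sum1_card leq_add2l.
  by rewrite ltn_add2l => /ltnW.
have close x y j : inl x \in S -> inl y \in S -> (val x j <= val y j + n.+1).
  move=> xS yS; have [jC|jC] := boolP (j \in C).
    by apply: leq_trans (split_sum x xS j jC) _; rewrite leq_add2r; exact: mn_le.
  by apply: leq_trans (out_sum x xS j jC) _; rewrite leq_addl.
exists x0 => i; have [iC|iC] := boolP (i \in C); last by right; exact: out_sum.
left; have : i \in c' @: S by rewrite fullS inE.
case/imsetP => -[x xS ix|j jS ij]; first by exists x => // j; split; exact: close.
by move: iC; rewrite ij inE jS.
Qed.
End Grid.

Local Open Scope classical_set_scope.
Local Open Scope ring_scope.

(** * Continuity on a subset *)

Section EpsDelta.
Context {R : realType}.

(** Continuity of the restriction of [g] to [D], in epsilon-delta form. *)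
Definition cont_on (V W : normedModType R) (D : set V) (g : V -> W) :=
  forall x, D x -> forall e, 0 < e -> exists2 d, 0 < d &
    forall y, D y -> `|y - x| < d -> `|g y - g x| < e.

Lemma cont_on_within (V W : normedModType R) (D : set V) (g : V -> W) :
  cont_on D g -> {within D, continuous g}.
Proof.
move=> cg; apply/subspace_continuousP => x Dx.
apply/cvgrPdist_lt => e e0; have [d d0 dP] := cg x Dx e e0.
rewrite near_withinE; apply/nbhs_normP; exists d => //= y yx Dy.
by rewrite distrC; apply: dP; rewrite // distrC.
Qed.

Lemma cont_on_at (V W : normedModType R) (D : set V) (g : V -> W) :
  (forall x, D x -> g @ x --> g x) -> cont_on D g.
Proof.
move=> cg x Dx e e0.
have /cvgrPdist_lt/(_ e e0)/nbhs_normP[d d0 dP] := cg x Dx.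
exists d => // y Dy yx.
by rewrite distrC; apply: dP => //=; rewrite distrC.
Qed.

Lemma within_cont_on (V W : normedModType R) (D : set V) (g : V -> W) :
  {within D, continuous g} -> cont_on D g.
Proof.
move=> /subspace_continuousP cg x Dx e e0.
have /cvgrPdist_lt/(_ e e0) := cg x Dx.
rewrite near_withinE => /nbhs_normP[d d0 dP]; exists d => // y Dy yx.
by rewrite distrC; apply: dP => //=; rewrite distrC.
Qed.

Lemma finite_ball_cover (V : normedModType R) (D : set V) (delta : V -> R) :
  compact D -> (forall x, D x -> 0 < delta x) ->
  exists2 s : seq V, (forall x, x \in s -> D x) &
    forall y, D y -> exists2 x, x \in s & `|y - x| < delta x.
Proof.
rewrite compact_cover => cD d0.
have [||F FD cF] := cD V D (fun x => ball x (delta x)).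
- by move=> x Dx; apply: ball_open; exact: d0.
- move=> y Dy; exists y => //; apply: ballxx; exact: d0.
exists (finmap.enum_fset F) => [x /FD|y /cF [x /= xF]]; first by rewrite inE.
by rewrite -ball_normE /= distrC => yx; exists x.
Qed.

Lemma unif_cont_on (V W : normedModType R) (D : set V) (g : V -> W) :
  compact D -> cont_on D g -> forall e, 0 < e -> exists2 d, 0 < d &
    forall x y, D x -> D y -> `|y - x| < d -> `|g y - g x| < e.
Proof.
move=> cD cg e e0.
have /choice[delta dP] (x : V) : exists d, D x -> 0 < d /\
    forall y, D y -> `|y - x| < d + d -> `|g y - g x| < e / 2.
  have [Dx|nDx] := pselect (D x); last by exists 0.
  have [|d d0 H] := cg x Dx (e / 2); first by rewrite divr_gt0.
  exists (d / 2) => _; split; first by rewrite divr_gt0.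
  by rewrite -splitr.
have [|s sD sP] := @finite_ball_cover V D delta cD.
  by move=> x Dx; have [] := dP x Dx.
have [d d0 dle] : exists2 d, 0 < d & forall x, x \in s -> d <= delta x.
  have {sP} : forall x, x \in s -> 0 < delta x.
    by move=> x /sD Dx; have [] := dP x Dx.
  elim: s {sD} => [_|a s IH H]; first by exists 1.
  have [|d d0 dl] := IH; first by move=> x xs; apply: H; rewrite inE xs orbT.
  exists (Num.min d (delta a)); first by rewrite lt_min d0 H // inE eqxx.
  move=> x; rewrite inE => /orP[/eqP->|/dl h]; first by rewrite ge_min lexx orbT.
  by rewrite ge_min h.
exists d => // x y Dx Dy xy; have [z zs xz] := sP x Dx.
have [_ H] := dP z (sD z zs); have dz := dle z zs.
have gx : `|g x - g z| < e / 2.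
  apply: H => //; rewrite (lt_trans xz) // ltrDl; exact: lt_le_trans dz.
have gy : `|g y - g z| < e / 2.
  apply: H => //; rewrite -(subrKA x); apply: le_lt_trans (ler_normD _ _) _.
  by rewrite addrC ltrD // (lt_le_trans xy).
rewrite -(subrKA (g z)) (le_lt_trans (ler_normD _ _)) // [ltRHS]splitr ltrD //.
by rewrite distrC.
Qed.

Lemma lipschitz_continuous (V W : normedModType R) (h : V -> W) k : 0 < k ->
  (forall x y, `|h x - h y| <= k * `|x - y|) -> continuous h.
Proof.
move=> k0 hk x; apply/cvgrPdist_lt => e e0; apply/nbhs_normP.
exists (e / k); first by rewrite /= divr_gt0.
by move=> y /= xy; rewrite (le_lt_trans (hk _ _)) // mulrC -ltr_pdivlMr.
Qed.

Lemma cont_on_comp (U V W : normedModType R) (D : set V) (g : V -> W) (p : U -> V) :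
  cont_on D g -> (forall x, D (p x)) -> continuous p -> continuous (g \o p).
Proof.
move=> cg pD cp x; apply/cvgrPdist_lt => e e0.
have [d d0 dP] := cg (p x) (pD x) e e0.
have /cvgrPdist_lt/(_ d d0) := cp x.
apply: filterS => y xy; rewrite distrC; apply: dP => //.
by rewrite distrC.
Qed.

Lemma comp_cont_on (U V W : normedModType R) (D : set U) (g : U -> V) (p : V -> W) :
  cont_on D g -> continuous p -> cont_on D (p \o g).
Proof.
move=> cg cp x Dx e e0.
have /cvgrPdist_lt/(_ e e0)/nbhs_normP[d d0 dP] := cp (g x).
have [d' d'0 d'P] := cg x Dx d d0; exists d' => // y Dy /(d'P y Dy) gyx.
by rewrite distrC; apply: dP; rewrite /= distrC.
Qed.

Lemma rV_norm_le n (x : 'rV[R]_n) e : 0 <= e -> (forall i, `|x 0 i| <= e) ->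
  `|x| <= e.
Proof.
move=> e0 H; rewrite [leLHS]/Num.norm /= mx_normrE; apply/bigmax_leP; split=> //.
by move=> [i j] _ /=; rewrite ord1.
Qed.

Lemma rV_coord_le n (x : 'rV[R]_n) i : `|x 0 i| <= `|x|.
Proof.
rewrite [leRHS]/Num.norm /= mx_normrE; apply/bigmax_geP; right.
by exists (0, i).
Qed.

Lemma coord_cont n (i : 'I_n) : continuous (fun x : 'rV[R]_n => x 0 i).
Proof. exact: coord_continuous. Qed.

End EpsDelta.

Section ContinuityRV.
Context {R : realType}.

Lemma continuous_sum (V : topologicalType) (W : normedModType R) (I : Type)
    (s : seq I) (F : I -> V -> W) :
  (forall i, continuous (F i)) -> continuous (fun x => \sum_(i <- s) F i x).
Proof.
move=> cF; elim: s => [|i s IH].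
  by under eq_fun do rewrite big_nil; exact: cst_continuous.
under eq_fun do rewrite big_cons.
by move=> x; apply: cvgD; [exact: cF|exact: IH].
Qed.

Lemma continuous_bump (V : normedModType R) (c : V) (r : R) :
  continuous (fun x : V => Num.max 0 (r - `|x - c|)).
Proof.
move=> x.
have : {for x, continuous ((fun=> 0 : R^o) \max (fun x : V => r - `|x - c| : R^o))}.
  apply: continuous_max; first exact: cvg_cst.
  apply: cvgB; first exact: cvg_cst.
  by apply: cvg_norm; apply: cvgB; [exact: cvg_id|exact: cvg_cst].
exact.
Qed.

Lemma continuous_scale (V : topologicalType) (W : normedModType R) (h : V -> R) (y : W) :
  continuous h -> continuous (fun x => h x *: y).
Proof. by move=> ch x; apply: cvgZ; [exact: ch|exact: cvg_cst]. Qed.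

Lemma cvg_weighted_mean (V W : normedModType R) (I : Type) (s : seq I)
    (w : I -> V -> R) (y : I -> W) x :
  (forall i, continuous (w i)) -> \sum_(i <- s) w i x != 0 ->
  (\sum_(i <- s) w i z)^-1 *: (\sum_(i <- s) w i z *: y i) @[z --> x] -->
  (\sum_(i <- s) w i x)^-1 *: (\sum_(i <- s) w i x *: y i).
Proof.
move=> cw W0; apply: cvgZ; first apply: cvgV => //.
  by apply: (@continuous_sum _ R^o).
apply: (@continuous_sum _ W _ s (fun i x => w i x *: y i)) => i.
exact: continuous_scale.
Qed.

Lemma continuous_affine (V : topologicalType) (h : V -> R) a b :
  continuous h -> continuous (fun x => a * h x + b).
Proof.
move=> ch x; apply: cvgD; last exact: cvg_cst.
by apply: cvgM; [exact: cvg_cst|exact: ch].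
Qed.

Lemma continuous_rV (V : topologicalType) n (h : V -> 'rV[R]_n) :
  (forall i, continuous (fun x => h x 0 i)) -> continuous h.
Proof.
move=> ch x; apply/cvgrPdist_le => e e0.
have : \forall y \near x, forall i, `|h x 0 i - h y 0 i| <= e.
  by apply: filter_forall => i; have /cvgrPdist_le/(_ e e0) := ch i x.
apply: filterS => y H; apply: rV_norm_le (ltW e0) _ => i.
by rewrite !mxE.
Qed.

Lemma cont_onD (V W : normedModType R) (D : set V) (f g : V -> W) :
  cont_on D f -> cont_on D g -> cont_on D (fun x => f x + g x).
Proof.
move=> cf cg x Dx e e0; have e2 : 0 < e / 2 by rewrite divr_gt0.
have [d1 d10 d1P] := cf x Dx _ e2; have [d2 d20 d2P] := cg x Dx _ e2.
exists (Num.min d1 d2); first by rewrite lt_min d10.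
move=> y Dy; rewrite lt_min => /andP[/(d1P y Dy) h1 /(d2P y Dy) h2].
by rewrite opprD addrACA (le_lt_trans (ler_normD _ _)) // [ltRHS]splitr ltrD.
Qed.

Lemma cont_onZ (V W : normedModType R) (D : set V) (f : V -> W) a :
  cont_on D f -> cont_on D (fun x => a *: f x).
Proof.
move=> cf x Dx e e0; have a0 : 0 < `|a| + 1 by rewrite ltr_wpDl.
have [|d d0 dP] := cf x Dx (e / (`|a| + 1)); first by rewrite divr_gt0.
exists d => // y Dy /(dP y Dy); rewrite ltr_pdivlMr // => h.
rewrite -scalerBr normrZ; apply: le_lt_trans h; rewrite mulrC ler_wpM2l //.
by rewrite lerDl.
Qed.

End ContinuityRV.

(** * Brouwer's theorem on a simplex *)

Section Simplex.
Context {R : realType}.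
Variable n : nat.

(** The standard simplex, in barycentric coordinates. *)
Definition simplex : set 'rV[R]_n.+1 :=
  [set x | (forall i, 0 <= x 0 i) /\ \sum_i x 0 i = 1].

Lemma simplex_le1 x i : simplex x -> x 0 i <= 1.
Proof.
by move=> [x0 <-]; rewrite (bigD1 i) //= lerDl sumr_ge0.
Qed.

Lemma simplex_compact : compact simplex.
Proof.
apply: bounded_closed_compact.
  exists 1; split=> // M M1 x sx; apply: rV_norm_le => [|i].
    by rewrite (le_trans ler01) // ltW.
  have [x0 _] := sx; rewrite ger0_norm // (le_trans (simplex_le1 i sx)) // ltW //.
have -> : simplex = (\bigcap_(i in [set: 'I_n.+1]) [set x : 'rV[R]_n.+1 | 0 <= x 0 i]) `&`
   [set x : 'rV[R]_n.+1 | \sum_i x 0 i = 1].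
  apply/seteqP; split => x /= [x0 x1]; split => // i; first by move=> _; exact: x0.
  exact: x0.
apply: closedI.
  apply: closed_bigI => i _.
  apply: (@closed_comp _ _ (fun x : 'rV[R]_n.+1 => x 0 i) [set y | 0 <= y]).
    by move=> x _; exact: coord_cont.
  exact: closed_ge.
apply: (@closed_comp _ _ (fun x : 'rV[R]_n.+1 => \sum_i x 0 i) [set y | y = 1]).
  by move=> x _; apply: continuous_sum => i; exact: coord_cont.
exact: closed_eq.
Qed.

(** Colour a grid point [x] by a coordinate [i] with [x i <= F x i].  Then
[scarf_grid] gives points with [x - e <= F x] coordinatewise, hence
[F x] near [x] as the coordinates of both sum to 1; compactness concludes. *)
Lemma brouwer_simplex (F : 'rV[R]_n.+1 -> 'rV[R]_n.+1) :
  (forall x, simplex x -> simplex (F x)) -> cont_on simplex F ->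
  exists2 x, simplex x & F x = x.
Proof.
move=> FS cF.
have approx e : 0 < e -> exists2 x, simplex x & forall i, x 0 i - e <= F x 0 i.
  move=> e0; have e20 : 0 < e / 2 by rewrite divr_gt0.
  have [d d0 dP] := unif_cont_on simplex_compact cF e20.
  pose K : R := n.+2%:R.
  have K0 : 0 < K by rewrite ltr0n.
  have m0 : 0 < Num.min d (e / 2) by rewrite lt_min d0.
  pose N := (Num.bound (K / Num.min d (e / 2))).
  have Nlt : K / Num.min d (e / 2) < N%:R.
    by rewrite archi_boundP // divr_ge0 // ltW.
  have N0 : 0 < N%:R :> R by apply: le_lt_trans Nlt; rewrite divr_ge0 // ltW.
  have KN : K / N%:R < Num.min d (e / 2).
    by rewrite ltr_pdivrMr // mulrC -ltr_pdivrMr.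
  move: KN; rewrite lt_min => /andP[KNd KNe].
  have nK : n.+1%:R <= K by rewrite ler_nat.
  pose p (x : grid n N) : 'rV[R]_n.+1 := \row_i ((val x i : nat)%:R / N%:R).
  have pS x : simplex (p x).
    split=> [i|]; first by rewrite mxE divr_ge0 // ler0n.
    under eq_bigr do rewrite mxE.
    by rewrite -mulr_suml -natr_sum grid_sum divff // gt_eqF.
  have /choice[c cP] (x : grid n N) : exists i, p x 0 i <= F (p x) 0 i.
    apply: contrapT => /forallNP H.
    have : \sum_i F (p x) 0 i < \sum_i p x 0 i.
      apply: ltr_sum; first by apply/hasP; exists ord0; rewrite ?mem_index_enum.
      by move=> i _; rewrite ltNge; apply/negP/H.
    by rewrite (FS _ (pS x)).2 (pS x).2 ltxx.
  have [x0 H] := scarf_grid c; exists (p x0) => // i.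
  case: (H i) => [[x cx xx0]|le].
    have dist j : `|p x 0 j - p x0 0 j| <= n.+1%:R / N%:R.
      rewrite !mxE -mulrBl normrM [`|N%:R^-1|]ger0_norm ?invr_ge0 ?ler0n //.
      rewrite ler_wpM2r ?invr_ge0 ?ler0n //.
      have [h1 h2] := xx0 j.
      by rewrite ler_norml lerNl opprB !lerBlDl -!natrD !ler_nat h1 h2.
    have close : `|p x - p x0| < d.
      apply: le_lt_trans KNd; apply: rV_norm_le => [|j].
        by rewrite divr_ge0 // ?ler0n // ltW.
      rewrite !mxE; have := dist j; rewrite !mxE => h.
      by apply: le_trans h _; rewrite ler_pM2r ?invr_gt0.
    have hF : `|F (p x) 0 i - F (p x0) 0 i| < e / 2.
      have := dP _ _ (pS x0) (pS x) close; apply: le_lt_trans.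
      by have := rV_coord_le (F (p x) - F (p x0)) i; rewrite !mxE.
    have hx : `|p x 0 i - p x0 0 i| < e / 2.
      by apply: le_lt_trans (dist i) (le_lt_trans _ KNe); rewrite ler_pM2r ?invr_gt0.
    have := cP x; rewrite cx => hc.
    move: hF hx; rewrite !ltr_norml => /andP[? ?] /andP[? ?]; lra.
  have [F0 _] := FS _ (pS x0); apply: le_trans (F0 i).
  rewrite subr_le0 mxE (@le_trans _ _ (K / N%:R)) //.
    by rewrite ler_pM2r ?invr_gt0 // ler_nat; exact: leqW.
  by rewrite (le_trans (ltW KNe)) // ler_pdivrMr // ler_peMr ?ltW // ltr1n.
have s0 : simplex !=set0.
  exists (\row_i (i == ord0)%:R); split=> [i|]; first by rewrite mxE ler0n.
  under eq_bigr do rewrite mxE.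
  by rewrite (bigD1 ord0) //= big1 ?addr0 // => j /negPf->.
have [c cS cmin] : exists2 c, simplex c & forall x, simplex x -> `|F c - c| <= `|F x - x|.
  have [|c cS cmin] := @compact_EVT_min _ R (fun x => `|F x - x|) simplex s0 simplex_compact.
    apply: cont_on_within => x sx e e0.
    have [|d d0 dP] := cF x sx (e / 2); first by rewrite divr_gt0.
    exists (Num.min d (e / 2)); first by rewrite lt_min d0 divr_gt0.
    move=> y sy; rewrite lt_min => /andP[yxd yxe].
    apply: le_lt_trans (ler_dist_dist _ _) _.
    rewrite (_ : F y - y - (F x - x) = (F y - F x) - (y - x)); last first.
      by rewrite !opprD addrACA.
    apply: le_lt_trans (ler_normB _ _) _; rewrite [ltRHS]splitr ltrD //.
    exact: dP.
  by exists c => [|x sx]; [rewrite inE in cS|apply: cmin; rewrite inE].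
exists c => //; apply/eqP; rewrite -subr_eq0 -normr_le0 leNgt; apply/negP => m0.
have n0 : 0 < n.+2%:R :> R by rewrite ltr0n.
have [|x sx xP] := approx (`|F c - c| / n.+2%:R); first by rewrite divr_gt0.
set e := `|F c - c| / n.+2%:R in xP.
have e0 : 0 < e by rewrite divr_gt0.
have : `|F x - x| <= n.+1%:R * e.
  apply: rV_norm_le => [|i]; first by rewrite mulr_ge0 ?ler0n // ltW.
  rewrite !mxE.
  have sum0 : \sum_j (F x 0 j - x 0 j) = 0.
    by rewrite sumrB (FS _ sx).2 sx.2 subrr.
  have lo j : - e <= F x 0 j - x 0 j by have := xP j; lra.
  have hi : F x 0 i - x 0 i <= n%:R * e.
    move: sum0; rewrite (bigD1 i) //= => /eqP; rewrite addr_eq0 => /eqP->.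
    rewrite lerNl -mulrN mulr_natl.
    rewrite (_ : - e *+ n = \sum_(j | j != i) - e); first by apply: ler_sum => j _.
    by rewrite sumr_const cardC1 card_ord.
  rewrite ler_norml -natr1 mulrDl mul1r; apply/andP; split; last by lra.
  by apply: le_trans (lo i); rewrite lerN2 lerDr mulr_ge0 ?ler0n // ltW.
rewrite leNgt => /negP; apply; apply: lt_le_trans (cmin _ sx).
rewrite /e mulrCA gtr_pMr // ltr_pdivrMr // mul1r ltr_nat //.
Qed.

End Simplex.

(** * Euclidean geometry and metric projections *)

Section Euclid.
Context {R : realType} {n : nat}.
Notation V := 'rV[R]_n.
Implicit Types (x y z u v w : V) (A D : set V).

(** The Euclidean inner product. *)
Definition dot (u v : V) : R := \sum_i u 0 i * v 0 i.

Lemma dotC u v : dot u v = dot v u.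
Proof. by apply: eq_bigr => i _; rewrite mulrC. Qed.

Lemma dotDl u v w : dot (u + v) w = dot u w + dot v w.
Proof. by rewrite -big_split; apply: eq_bigr => i _; rewrite mxE mulrDl. Qed.

Lemma dotZl a u w : dot (a *: u) w = a * dot u w.
Proof. by rewrite mulr_sumr; apply: eq_bigr => i _; rewrite mxE mulrA. Qed.

Lemma dotNl u w : dot (- u) w = - dot u w.
Proof. by rewrite -scaleN1r dotZl mulN1r. Qed.

Lemma dotDr u v w : dot w (u + v) = dot w u + dot w v.
Proof. by rewrite dotC dotDl !(dotC w). Qed.

Lemma dotZr a u w : dot w (a *: u) = a * dot w u.
Proof. by rewrite dotC dotZl (dotC w). Qed.

Lemma dotNr u w : dot w (- u) = - dot w u.
Proof. by rewrite dotC dotNl (dotC w). Qed.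

Definition dotE := (dotDl, dotDr, dotNl, dotNr, dotZl, dotZr).

Lemma dot_ge0 u : 0 <= dot u u.
Proof. by apply: sumr_ge0 => i _; rewrite -expr2 sqr_ge0. Qed.

Lemma dot_sqr_coord u i : u 0 i ^+ 2 <= dot u u.
Proof.
rewrite /dot (bigD1 i) //= -expr2 lerDl; apply: sumr_ge0 => j _.
by rewrite -expr2 sqr_ge0.
Qed.

Lemma dot_eq0 u : dot u u <= 0 -> u = 0.
Proof.
move=> u0; apply/rowP => i; rewrite mxE; apply/eqP; rewrite -sqrf_eq0.
by rewrite eq_le sqr_ge0 andbT (le_trans (dot_sqr_coord u i)).
Qed.

Lemma dot_le_norm u : dot u u <= n%:R * `|u| ^+ 2.
Proof.
have -> : n%:R * `|u| ^+ 2 = \sum_(i < n) `|u| ^+ 2.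
  by rewrite sumr_const card_ord mulr_natl.
apply: ler_sum => i _.
by rewrite -expr2 -real_normK ?num_real // lerXn2r ?nnegrE // rV_coord_le.
Qed.

Lemma norm_le_dot u e : 0 <= e -> dot u u <= e ^+ 2 -> `|u| <= e.
Proof.
move=> e0 ue; apply: rV_norm_le => // i.
rewrite -(ler_pXn2r (n := 2)) ?nnegrE // -normrX ger0_norm ?sqr_ge0 //.
exact: le_trans (dot_sqr_coord u i) ue.
Qed.

Lemma continuous_dot (p : V) : continuous (dot p).
Proof.
apply: continuous_sum => i x.
by apply: continuousM; [exact: cst_continuous|exact: coord_cont].
Qed.

Lemma continuous_dot_self : continuous (fun u => dot u u).
Proof. by apply: continuous_sum => i x; apply: continuousM; exact: coord_cont. Qed.

Lemma enormE u : enorm u = Num.sqrt (dot u u).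
Proof. by congr Num.sqrt; apply: eq_bigr => i _; rewrite expr2. Qed.


Lemma enorm_sqr u : enorm u ^+ 2 = dot u u.
Proof. by rewrite enormE sqr_sqrtr // dot_ge0. Qed.

Lemma enorm_ge0 u : 0 <= enorm u.
Proof. by rewrite enormE sqrtr_ge0. Qed.

Lemma enorm_ltr u e : 0 <= e -> (enorm u < e) = (dot u u < e ^+ 2).
Proof. by move=> e0; rewrite -enorm_sqr ltr_pXn2r // nnegrE // enorm_ge0. Qed.

Lemma enorm_ler u e : 0 <= e -> (enorm u <= e) = (dot u u <= e ^+ 2).
Proof. by move=> e0; rewrite -enorm_sqr ler_pXn2r // nnegrE // enorm_ge0. Qed.

(** Convexity, with a real parameter in place of one bundled with its bounds. *)
Definition cvx A :=
  forall x y t, A x -> A y -> 0 <= t <= 1 -> A (t *: x + (1 - t) *: y).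

Lemma dot_conv x y t : dot (t *: x + (1 - t) *: y) (t *: x + (1 - t) *: y)
  = t * dot x x + (1 - t) * dot y y - t * (1 - t) * dot (x - y) (x - y).
Proof. rewrite !dotE (dotC y x); ring. Qed.

Lemma dot_conv_le x y t : 0 <= t <= 1 ->
  dot (t *: x + (1 - t) *: y) (t *: x + (1 - t) *: y)
  <= t * dot x x + (1 - t) * dot y y.
Proof.
move=> /andP[t0 t1]; rewrite dot_conv gerBl mulr_ge0 ?dot_ge0 // mulr_ge0 //.
by rewrite subr_ge0.
Qed.

(** The metric projection, with its variational characterization. *)
Lemma proj_exists D : compact D -> cvx D -> D !=set0 ->
  exists p : V -> V, (forall x, D (p x)) /\
    forall x y, D y -> dot (x - p x) (y - p x) <= 0.
Proof.
move=> cD vD D0.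
suff /choice[p pP] : forall x, exists p, D p /\ forall y, D y -> dot (x - p) (y - p) <= 0.
  by exists p; split=> x; have [] := pP x.
move=> x.
have [|p pD pmin] := @compact_EVT_min _ R (fun p : V => dot (x - p) (x - p)) D D0 cD.
  apply: continuous_subspaceT => p.
  apply: (@continuous_comp _ _ _ (fun p : V => x - p) (fun u : V => dot u u)).
    by apply: continuousB; [exact: cst_continuous|].
  exact: continuous_dot_self.
exists p; rewrite inE in pD; split=> // y yD; rewrite leNgt; apply/negP => a0.
set a := dot _ _ in a0; pose b := dot (y - p) (y - p).
have b0 : 0 <= b by exact: dot_ge0.
(* Moving from [p] towards [y] by this [t] would decrease the distance. *)
pose t := a / (a + b); have ab0 : 0 < a + b by rewrite ltr_wpDr.
have t0 : 0 < t by rewrite divr_gt0.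
have t1 : t <= 1 by rewrite ler_pdivrMr // mul1r lerDl.
have tE : t * (a + b) = a by rewrite divfK // gt_eqF.
have : dot (x - p) (x - p) <= dot (x - p) (x - p) - 2 * t * a + t ^+ 2 * b.
  have := pmin (t *: y + (1 - t) *: p).
  rewrite inE => /(_ (vD _ _ _ yD pD _)); rewrite (ltW t0) t1 => /(_ isT).
  rewrite (_ : x - (t *: y + (1 - t) *: p) = (x - p) - t *: (y - p)); last first.
    by apply/rowP => i; rewrite !mxE; ring.
  move=> h; apply: le_trans h _; rewrite le_eqVlt; apply/orP; left; apply/eqP.
  by rewrite /a /b !dotE (dotC y x) (dotC p x) (dotC p y); ring.
have e : t * b = a - t * a by move: tE; lra.
have -> : t ^+ 2 * b = t * (a - t * a) by rewrite -e; ring.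
move=> h.
have ta : 0 < t * a by rewrite mulr_gt0.
have tta : 0 < t * (t * a) by rewrite mulr_gt0.
lra.
Qed.

Section Proj.
Variables (D : set V) (p : V -> V).
Hypothesis pD : forall x, D (p x).
Hypothesis pP : forall x y, D y -> dot (x - p x) (y - p x) <= 0.

Lemma proj_id x : D x -> p x = x.
Proof. by move=> /(pP x)/dot_eq0/eqP; rewrite subr_eq0 => /eqP. Qed.

(** Nonexpansiveness for the Euclidean norm; the factor comes from the
comparison with the sup norm. *)
Lemma proj_lipschitz x y : `|p x - p y| <= n.+1%:R * `|x - y|.
Proof.
apply: norm_le_dot; first by rewrite mulr_ge0 ?ler0n.
have h1 := pP x (pD y); have h2 := pP y (pD x).
have h3 := dot_ge0 ((x - y) - (p x - p y)).
have h4 : dot (p x - p y) (p x - p y) <= dot (x - y) (x - y).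
  move: h1 h2 h3; rewrite !dotE; rewrite (dotC y x) (dotC (p x) x) (dotC (p y) x)
   (dotC (p x) y) (dotC (p y) y) (dotC (p y) (p x)).
  lra.
apply: le_trans h4 (le_trans (dot_le_norm _) _).
rewrite exprMn ler_wpM2r ?sqr_ge0 // -natrX ler_nat.
by rewrite (leq_trans (leqnSn n)) // -mulnn leq_pmulr.
Qed.

Lemma proj_continuous : continuous p.
Proof.
apply: (@lipschitz_continuous R _ _ p n.+1%:R); first by rewrite ltr0n.
exact: proj_lipschitz.
Qed.

End Proj.

Lemma compact_norm_bound D : compact D -> exists2 M, 0 < M & forall x, D x -> `|x| <= M.
Proof.
move=> /compact_bounded/ex_strict_bound_gt0 [M M0 MP].
by exists M => // x Dx; apply: ltW; exact: MP.
Qed.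

End Euclid.

(** * Brouwer's theorem on a compact convex set *)

(** [D] is embedded in the simplex by the affine map [psi], whose left inverse
is [phi]; the projection [p] onto [D] extends [g] to the whole space. *)
Lemma brouwer_compact_convex (R : realType) n (D : set 'rV[R]_n) g :
  compact D -> cvx D -> D !=set0 -> cont_on D g -> (forall x, D x -> D (g x)) ->
  exists2 x, D x & g x = x.
Proof.
move=> cD vD D0 cg gD; have [p [pD pP]] := proj_exists cD vD D0.
have [M M0 MP] := compact_norm_bound cD.
have D_coord z i : D z -> - M <= z 0 i <= M.
  by move=> /MP zM; rewrite -ler_norml (le_trans (rV_coord_le z i)).
pose L : R := 2 * M * n.+1%:R; have L0 : 0 < L by rewrite !mulr_gt0 // ltr0n.
pose phi (u : 'rV[R]_n.+1) : 'rV[R]_n := \row_i (L * u 0 (lift ord0 i) - M).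
pose b i (z : 'rV[R]_n) := L^-1 * z 0 i + M / L.
pose psi (z : 'rV[R]_n) : 'rV[R]_n.+1 := \row_j
  if unlift ord0 j is Some i then b i z else -1 * \sum_i b i z + 1.
have bE i z : b i z = (z 0 i + M) / L by rewrite mulrDl mulrC.
have psi0 z : psi z 0 ord0 = -1 * \sum_i b i z + 1 by rewrite mxE unlift_none.
have psiS z i : psi z 0 (lift ord0 i) = b i z by rewrite mxE liftK.
have phiK z : phi (psi z) = z.
  apply/rowP => i; rewrite mxE psiS bE mulrC divfK ?addrK // gt_eqF //.
have psiD z : D z -> simplex (psi z).
  move=> Dz; split; last first.
    rewrite big_ord_recl psi0 mulN1r addrAC.
    rewrite [X in _ + X + _](eq_bigr (b^~ z)) ?addNr ?add0r //.

  have zi i : 0 <= b i z <= n.+1%:R^-1.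
    have /andP[lo hi] := D_coord z i Dz.
    rewrite bE divr_ge0 ?(ltW L0) /=; [|by rewrite -lerBlDr sub0r|by []].
    rewrite ler_pdivrMr // /L mulrC mulfK ?gt_eqF ?ltr0n //; lra.
  move=> j; case: (unliftP ord0 j) => [i|] ->.
    by rewrite psiS; have /andP[] := zi i.
  rewrite psi0 mulN1r addrC subr_ge0; apply: (@le_trans _ _ (\sum_(i < n) n.+1%:R^-1)).
    by apply: ler_sum => i _; have /andP[] := zi i.
  rewrite sumr_const card_ord -[leLHS]mulr_natr [leLHS]mulrC ler_pdivrMr ?ltr0n // mul1r.
  by rewrite ler_nat.
have phiS_cont i : continuous (fun u : 'rV[R]_n.+1 => L * u 0 (lift ord0 i) - M).
  exact: (@continuous_affine _ _ (fun u : 'rV[R]_n.+1 => u 0 (lift ord0 i))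
    L (- M) (@coord_cont _ _ _)).
have phi_cont : continuous phi.
  apply: continuous_rV => i; have := phiS_cont i.
  by rewrite (_ : (fun x => phi x 0 i) = fun u => L * u 0 (lift ord0 i) - M) //;
    apply/funext => u; rewrite mxE.
have b_cont i : continuous (b i).
  exact: (@continuous_affine _ _ (fun z : 'rV[R]_n => z 0 i) _ _ (@coord_cont _ _ _)).
have psi_cont : continuous psi.
  apply: continuous_rV => j; case: (unliftP ord0 j) => [i|] ->.
    by rewrite (_ : (fun x => psi x 0 _) = b i) //; apply/funext => z; rewrite psiS.
  rewrite (_ : (fun x => psi x 0 _) = fun z => -1 * \sum_i b i z + 1).
    by apply: (@continuous_affine _ _ (fun z => \sum_i b i z)); exact: continuous_sum.
  by apply/funext => z; rewrite psi0.
have gp_cont : continuous (g \o p).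
  by apply: (cont_on_comp cg) => //; exact: (proj_continuous pD pP).
have [||u su uE] := @brouwer_simplex R n (psi \o (g \o p) \o phi).
- by move=> u _; apply: psiD; apply: gD; exact: pD.
- apply: within_cont_on; apply: continuous_subspaceT => u.
  apply: continuous_comp; first exact: phi_cont.
  by apply: continuous_comp; [exact: gp_cont|exact: psi_cont].
have zE : g (p (phi u)) = phi u by rewrite -[in RHS]uE /= phiK.
have Dz : D (phi u) by rewrite -zE; apply: gD; exact: pD.
by exists (phi u); rewrite // -[in RHS]zE (proj_id pP Dz).
Qed.

(** * Approximate selections *)

Section Selection.
Context {R : realType}.

Lemma exists_expV2_lt (M e : R) : 0 < e -> exists k : nat, M * 2^-1 ^+ k < e.
Proof.
move=> e0; have [M0|M0] := leP M 0.
  by exists 0%N; rewrite expr0 mulr1 (le_lt_trans M0).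
exists (Num.bound (M / e)); rewrite exprVn ltr_pdivrMr ?exprn_gt0 // mulrC.
rewrite -ltr_pdivrMr //; apply: lt_le_trans (archi_boundP _) _.
  by rewrite divr_ge0 // ltW.
by rewrite -natrX ler_nat ltnW // ltn_expl.
Qed.

(** The limit is the supremum of the lower bounds [a k - r k], each of which is
at most every upper bound [a k + r k]. *)
Lemma real_geometric_limit (M : R) (a : nat -> R) : 0 <= M ->
  (forall k, `|a k.+1 - a k| <= M * 2^-1 ^+ k) ->
  exists l, forall k, `|l - a k| <= 2 * M * 2^-1 ^+ k.
Proof.
move=> M0 Ha; pose r k := 2 * M * 2^-1 ^+ k : R.
have rS k : r k.+1 = r k - M * 2^-1 ^+ k by rewrite /r exprS; field.
have r0 k : 0 <= r k by rewrite !mulr_ge0 // exprn_ge0.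
have lo : {homo (fun k => a k - r k) : k m / (k <= m)%N >-> k <= m}.
  apply: homo_leq => [//|y x z|k]; first exact: le_trans.
  by have := Ha k; rewrite rS ler_norml => /andP[h _]; lra.
have hi : {homo (fun k => a k + r k) : k m / (k <= m)%N >-> k >= m}.
  apply: homo_leq => [//|y x z h1 h2|k]; first exact: le_trans h2 h1.
  by have := Ha k; rewrite rS ler_norml => /andP[_ h]; lra.
pose B := range (fun k => a k - r k).
have ubB k : ubound B (a k + r k).
  move=> _ [m _ <-].
  have h1 := lo _ _ (leq_maxl m k); have h2 := hi _ _ (leq_maxr m k).
  by have := r0 (maxn m k); move: h1 h2 => /=; lra.
exists (sup B) => k; rewrite ler_norml; apply/andP; split.
  rewrite lerBrDr addrC; apply: ub_le_sup; first by exists (a 0%N + r 0%N); exact: ubB.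
  by exists k.
rewrite lerBlDr addrC; apply: ge_sup; last exact: ubB.
by exists (a 0%N - r 0%N), 0%N.
Qed.

Variable n : nat.
Notation V := 'rV[R]_n.
Implicit Types (D : set V) (T : V -> set V).

Lemma geometric_limit D (M : R) (h : nat -> V -> V) : 0 <= M ->
  (forall k, cont_on D (h k)) ->
  (forall k x, D x -> `|h k.+1 x - h k x| <= M * 2^-1 ^+ k) ->
  exists2 l : V -> V, cont_on D l &
    forall k x, D x -> `|l x - h k x| <= 2 * M * 2^-1 ^+ k.
Proof.
move=> M0 ch Hh.
have /choice[l lP] (x : V) : exists l : V, D x ->
    forall k, `|l - h k x| <= 2 * M * 2^-1 ^+ k.
  have [Dx|] := pselect (D x); last by exists 0.
  have /choice[l lP] (i : 'I_n) : exists l, forall k,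
      `|l - h k x 0 i| <= 2 * M * 2^-1 ^+ k.
    apply: real_geometric_limit => // k; apply: le_trans (Hh k x Dx).
    by have := rV_coord_le (h k.+1 x - h k x) i; rewrite !mxE.
  exists (\row_i l i) => _ k; apply: rV_norm_le => [|i].
    by rewrite !mulr_ge0 // exprn_ge0.
  by rewrite !mxE.
exists l => [x Dx e e0|k x Dx]; last exact: lP.
have e3 : 0 < e / 3 by rewrite divr_gt0.
have [k kP] := exists_expV2_lt (2 * M) e3.
have [d d0 dP] := ch k x Dx _ e3; exists d => // y Dy yx.
have h1 := le_lt_trans (lP x Dx k) kP.
have h2 := le_lt_trans (lP y Dy k) kP.
have h3 := dP y Dy yx.
have -> : l y - l x = (l y - h k y) + (h k y - h k x) + (h k x - l x).
  by rewrite subrKA subrKA.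
have := ler_normD (l y - h k y + (h k y - h k x)) (h k x - l x).
have := ler_normD (l y - h k y) (h k y - h k x).
rewrite (distrC (h k x)); lra.
Qed.

(** Lower semi-continuity on [D], in epsilon-delta form. *)
Definition lsc_on D T := forall x0, D x0 -> forall y, T x0 y ->
  forall e, 0 < e -> exists2 d, 0 < d &
    forall x, D x -> `|x - x0| < d -> exists2 y', T x y' & `|y' - y| < e.

Lemma lsc_on_ball D T (g : V -> V) (r : R) : lsc_on D T -> cont_on D g ->
  lsc_on D (fun x => [set y | T x y /\ `|y - g x| < r]).
Proof.
move=> lT cg x0 Dx0 y [Ty yr] e e0.
pose s := (r - `|y - g x0|) / 2; have s0 : 0 < s by rewrite divr_gt0 ?subr_gt0.
have [d1 d10 d1P] := cg x0 Dx0 s s0.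
have m0 : 0 < Num.min e s by rewrite lt_min e0.
have [d2 d20 d2P] := lT x0 Dx0 y Ty _ m0.
exists (Num.min d1 d2); first by rewrite lt_min d10.
move=> x Dx; rewrite lt_min => /andP[xd1 xd2].
have [y' Ty'] := d2P x Dx xd2; rewrite lt_min => /andP[y'e y's].
exists y' => //; split=> //.
have h := d1P x Dx xd1.
have -> : y' - g x = (y' - y) + (y - g x0) + (g x0 - g x) by rewrite !subrKA.
have := ler_normD (y' - y + (y - g x0)) (g x0 - g x).
have := ler_normD (y' - y) (y - g x0).
rewrite (distrC (g x0)); rewrite /s in y's h; lra.
Qed.

Lemma cvxI (A B : set V) : cvx A -> cvx B -> cvx (fun y => A y /\ B y).
Proof.
by move=> cA cB x y t [Ax Bx] [Ay By] t01; split; [exact: cA|exact: cB].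
Qed.

Lemma cvx_ball (c : V) (r : R) : cvx [set y | `|y - c| < r].
Proof.
move=> x y t /= xr yr /andP[t0 t1].
have -> : t *: x + (1 - t) *: y - c = t *: (x - c) + (1 - t) *: (y - c).
  by apply/rowP => i; rewrite !mxE; ring.
apply: le_lt_trans (ler_normD _ _) _; rewrite !normrZ (ger0_norm t0) ger0_norm ?subr_ge0 //.
have [->|t_neq0] := eqVneq t 0; first by rewrite mul0r subr0 mul1r add0r.
have tp : 0 < t by rewrite lt_neqAle eq_sym t_neq0.
have h1 : t * `|x - c| < t * r by rewrite ltr_pM2l.
have h2 : (1 - t) * `|y - c| <= (1 - t) * r by rewrite ler_wpM2l ?subr_ge0 // ltW.
lra.
Qed.

Lemma cvx_thicken (A : set V) e : cvx A -> cvx [set z | exists2 y, A y & `|z - y| < e].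
Proof.
move=> cA x y t [x' Ax' xx'] [y' Ay' yy'] t01; exists (t *: x' + (1 - t) *: y').
  exact: cA.
have -> : t *: x + (1 - t) *: y - (t *: x' + (1 - t) *: y') =
    t *: (x - x') + (1 - t) *: (y - y') - 0.
  by apply/rowP => i; rewrite !mxE; ring.
by apply: (@cvx_ball 0 e) => //=; rewrite subr0.
Qed.

Lemma cvx_wsum (A : set V) (I : eqType) (s : seq I) (w : I -> R) (y : I -> V) :
  cvx A -> (forall i, i \in s -> 0 <= w i) ->
  (forall i, i \in s -> 0 < w i -> A (y i)) ->
  0 < \sum_(i <- s) w i ->
  A ((\sum_(i <- s) w i)^-1 *: \sum_(i <- s) w i *: y i).
Proof.
move=> cA; elim: s => [|a s IH] w0 Ay; first by rewrite big_nil ltxx.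
have w0s i : i \in s -> 0 <= w i by move=> si; apply: w0; rewrite inE si orbT.
have Ays i : i \in s -> 0 < w i -> A (y i) by move=> si; apply: Ay; rewrite inE si orbT.
rewrite !big_cons => W0; have wa := w0 a (mem_head _ _).
have S0 : 0 <= \sum_(i <- s) w i by rewrite big_seq sumr_ge0.
have [wa0|wa0] := eqVneq (w a) 0.
  by rewrite wa0 !add0r scale0r add0r; apply: IH => //; move: W0; rewrite wa0 add0r.
have wap : 0 < w a by rewrite lt_neqAle eq_sym wa0.
have Aa : A (y a) by apply: Ay; rewrite ?mem_head.
have [S00|S00] := eqVneq (\sum_(i <- s) w i) 0.
  have -> : \sum_(i <- s) w i *: y i = 0.
    rewrite big_seq big1 // => i si.
    suff -> : w i = 0 by rewrite scale0r.
    apply/eqP; rewrite eq_le w0s // andbT -S00 (big_rem i) //= lerDl.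
    by rewrite big_seq sumr_ge0 // => j /mem_rem/w0s.
  by rewrite S00 !addr0 scalerA mulVf // scale1r.
have Sp : 0 < \sum_(i <- s) w i by rewrite lt_neqAle eq_sym S00.
set S := \sum_(i <- s) w i in W0 S0 S00 Sp *; set v := \sum_(i <- s) _.
have := cA _ _ (w a / (w a + S)) Aa (IH w0s Ays Sp) _.
rewrite -/S -/v (_ : _ + _ = (w a + S)^-1 *: (w a *: y a + v)); last first.
  apply/rowP => i; rewrite !mxE; field.
  by rewrite gt_eqF //= gt_eqF.
by apply; rewrite divr_ge0 ?(ltW W0) //= ler_pdivrMr // mul1r lerDl.
Qed.

(** A partition of unity subordinate to a finite cover on whose pieces [T] meets
a fixed ball of radius [e]. *)
Lemma approx_selection D T e : compact D -> lsc_on D T ->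
  (forall x, D x -> cvx (T x)) -> (forall x, D x -> T x !=set0) -> 0 < e ->
  exists2 g : V -> V, cont_on D g &
    forall x, D x -> exists2 y, T x y & `|g x - y| < e.
Proof.
move=> cD lT cT T0 e0.
have /choice[yd ydP] (x : V) : exists yd : V * R, D x -> [/\ T x yd.1, 0 < yd.2 &
    forall x', D x' -> `|x' - x| < yd.2 -> exists2 y', T x' y' & `|y' - yd.1| < e].
  have [Dx|] := pselect (D x); last by exists (0, 0).
  have [y Ty] := T0 x Dx; have [d d0 dP] := lT x Dx y Ty e e0.
  by exists (y, d).
have [|s sD sP] := finite_ball_cover (delta := fun x => (yd x).2) cD.
  by move=> x Dx; have [] := ydP x Dx.
pose w i (x : V) : R := Num.max 0 ((yd i).2 - `|x - i|).
have w0 i x : 0 <= w i x by rewrite le_max lexx.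
have wP i x : 0 < w i x -> `|x - i| < (yd i).2.
  by rewrite lt_max ltxx /= subr_gt0.
have W0 x : D x -> 0 < \sum_(i <- s) w i x.
  move=> Dx; have [i si xi] := sP x Dx.
  rewrite (big_rem i) //= ltr_wpDr ?sumr_ge0 // lt_max subr_gt0 xi orbT //.
pose g x := (\sum_(i <- s) w i x)^-1 *: \sum_(i <- s) w i x *: (yd i).1.
exists g => [|x Dx]; last first.
  apply: (@cvx_wsum [set z | exists2 y, T x y & `|z - y| < e]) => //.
  - by apply: cvx_thicken; exact: cT.
  - move=> i si /wP xi; have [_ _ H] := ydP i (sD i si).
    by have [y' Ty' y'e] := H x Dx xi; exists y'; rewrite // distrC.
  - exact: W0.
apply: cont_on_at => x Dx.
apply: (@cvg_weighted_mean R _ _ _ s w (fun i => (yd i).1)).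
  by move=> i; exact: continuous_bump.
by rewrite gt_eqF // W0.
Qed.

End Selection.

(** * Michael's selection theorem *)

Section Michael.
Context {R : realType} {n : nat}.
Notation V := 'rV[R]_n.
Implicit Types (D A : set V) (T : V -> set V).

Lemma expV2_gt0 k : 0 < 2^-1 ^+ k :> R.
Proof. by rewrite exprn_gt0. Qed.

(** The next approximation is sought in [T x] intersected with a ball around the
current one, whose radius is halved at each step. *)
Lemma closed_selection D T : compact D -> lsc_on D T ->
  (forall x, D x -> cvx (T x)) -> (forall x, D x -> T x !=set0) ->
  exists2 g : V -> V, cont_on D g &
    forall x, D x -> forall e, 0 < e -> exists2 y, T x y & `|g x - y| < e.
Proof.
move=> cD lT cT T0.
pose P k (g : V -> V) := cont_on D g /\
  forall x, D x -> exists2 y, T x y & `|g x - y| < 2^-1 ^+ k.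
have step k g : P k g -> exists g', P k.+1 g' /\
    forall x, D x -> `|g' x - g x| <= 2 * 2^-1 ^+ k.
  move=> [cg gP].
  have [||||g' cg' g'P] := @approx_selection R n D
      (fun x => [set y | T x y /\ `|y - g x| < 2^-1 ^+ k]) (2^-1 ^+ k.+1) cD.
  - exact: lsc_on_ball.
  - by move=> x Dx; apply: cvxI; [exact: cT|exact: cvx_ball].
  - by move=> x Dx; have [y Ty gy] := gP x Dx; exists y; split; rewrite // distrC.
  - exact: expV2_gt0.
  exists g'; split; first by split=> // x /g'P[y [Ty _] h]; exists y.
  move=> x /g'P[y [Ty h1] h2].
  have := ler_normD (g' x - y) (y - g x); rewrite subrKA.
  move: h2; rewrite exprS; have := expV2_gt0 k; lra.
have /choice[st stP] (kg : nat * (V -> V)) : exists g', P kg.1 kg.2 -> P kg.1.+1 g' /\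
    forall x, D x -> `|g' x - kg.2 x| <= 2 * 2^-1 ^+ kg.1.
  have [/step[g' ?]|] := pselect (P kg.1 kg.2); last by exists id.
  by exists g'.
have [g0 cg0 g0P] := approx_selection cD lT cT T0 ltr01.
pose G := fix G k := if k is k'.+1 then st (k', G k') else g0.
have PG k : P k (G k).
  elim: k => [|k IH]; first by split=> //; rewrite expr0.
  by have [] := stP (k, G k) IH.
have GS k x : D x -> `|G k.+1 x - G k x| <= 2 * 2^-1 ^+ k.
  by have [_] := stP (k, G k) (PG k); exact.
have [|l cl lP] := geometric_limit _ (fun k => (PG k).1) GS; first by [].
exists l => // x Dx e e0.
have [k kP] := exists_expV2_lt 5 e0.
have [y Ty h1] := (PG k).2 x Dx; exists y => //.
have h2 := lP k x Dx; have := ler_normD (l x - G k x) (G k x - y).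
rewrite subrKA; lra.
Qed.

Lemma dot_bound (p v : V) : `|dot p v| <= (\sum_i `|p 0 i|) * `|v|.
Proof.
rewrite mulr_suml; apply: le_trans (ler_norm_sum _ _ _) _; apply: ler_sum => i _.
by rewrite normrM ler_wpM2l // rV_coord_le.
Qed.

(** The image of a simplex; [a0] makes the family nonempty. *)
Lemma finite_hull A (s : seq V) (a0 : V) : cvx A -> A a0 -> (forall x, x \in s -> A x) ->
  exists D, [/\ compact D, cvx D, D `<=` A, D !=set0 & forall x, x \in s -> D x].
Proof.
move=> cA Aa0 As; pose m := size s.
pose a (i : 'I_m.+1) := nth a0 s i.
have Aa i : A (a i).
  by rewrite /a; case: (ltnP i m) => h; [apply: As; exact: mem_nth|rewrite nth_default].
pose phi (u : 'rV[R]_m.+1) : V := \sum_i u 0 i *: a i.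
have s_delta i : simplex (delta_mx 0 i : 'rV[R]_m.+1).
  split=> [j|]; first by rewrite mxE ler0n.
  by rewrite (bigD1 i) //= mxE !eqxx big1 ?addr0 // => j /negPf ji; rewrite mxE ji andbF.
have phi_delta i : phi (delta_mx 0 i) = a i.
  rewrite /phi (bigD1 i) //= mxE !eqxx scale1r big1 ?addr0 // => j /negPf ji.
  by rewrite mxE ji andbF scale0r.
exists (phi @` @simplex R m); split.
- apply: continuous_compact; last exact: simplex_compact.
  apply: continuous_subspaceT.
  apply: (@continuous_sum R _ _ _ _ (fun i (u : 'rV[R]_m.+1) => u 0 i *: a i)) => i.
  by apply: continuous_scale; exact: coord_cont.
- move=> _ _ t [u [u0 u1] <-] [v [v0 v1] <-] /andP[t0 t1].
  exists (t *: u + (1 - t) *: v).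
    split=> [i|]; first by rewrite !mxE addr_ge0 // mulr_ge0 // subr_ge0.
    under eq_bigr do rewrite !mxE.
    by rewrite big_split -!mulr_sumr /= u1 v1 !mulr1 addrC subrK.
  rewrite /phi !scaler_sumr -big_split; apply: eq_bigr => i _.
  by rewrite /= !scalerA -scalerDl !mxE.
- move=> _ [u [u0 u1] <-].
  have := @cvx_wsum R n A _ (index_enum 'I_m.+1) (fun i => u 0 i) a cA.
  by rewrite u1 invr1 scale1r; apply.
- by exists (a ord0), (delta_mx 0 ord0).
- move=> x xs; have xm : (index x s < m.+1)%N by rewrite ltnS ltnW // index_mem.
  exists (delta_mx 0 (Ordinal xm)) => //.
  by rewrite phi_delta /a /= nth_index.
Qed.

Lemma rowspace_closed (W : 'M[R]_n) : closed [set p : V | (p <= W)%MS].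
Proof.
have -> : [set p : V | (p <= W)%MS] =
    \bigcap_(j in [set: 'I_n]) [set p : V | dot (\row_i cokermx W i j) p = 0].
  apply/seteqP; split => p /=.
    rewrite submxE => /eqP pW j _ /=; have := congr1 (fun M : V => M 0 j) pW.
    by rewrite !mxE => <-; apply: eq_bigr => i _; rewrite mxE mulrC.
  move=> H; rewrite submxE; apply/eqP/rowP => j; rewrite [RHS]mxE -(H j I) mxE.
  by apply: eq_bigr => i _; rewrite mxE mulrC.
apply: closed_bigI => j _.
apply: (@closed_comp _ _ (dot (\row_i cokermx W i j)) [set y | y = 0]).
  by move=> x _; exact: continuous_dot.
exact: closed_eq.
Qed.

(** By compactness of the unit sphere of the row space of [W], it suffices to
support finitely many points of [A]; the point of their hull nearest to 0
does so. *)
Lemma weak_separation A (W : 'M[R]_n) : cvx A -> A !=set0 -> ~ A 0 ->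
  (forall a, A a -> (a <= W)%MS) ->
  exists p : V, [/\ (p <= W)%MS, p != 0 & forall a, A a -> 0 <= dot p a].
Proof.
move=> cA [a0 Aa0] nA0 AW.
pose S := [set p : V | (p <= W)%MS /\ dot p p = 1].
have cS : compact S.
  apply: bounded_closed_compact.
    exists 1; split=> // M M1 p [_ pp]; apply: norm_le_dot.
      by rewrite (le_trans ler01) // ltW.
    by rewrite pp expr_ge1 // ltW // (lt_trans ltr01).
  apply: closedI; first exact: rowspace_closed.
  apply: (@closed_comp _ _ (fun p : V => dot p p) [set y | y = 1]).
    by move=> x _; exact: continuous_dot_self.
  exact: closed_eq.
have [[p [[pW pp] pA]]|nex] := pselect (exists p, S p /\ forall a, A a -> 0 <= dot p a).
  exists p; split=> //; apply/eqP => p0; move: pp; rewrite p0 /dot.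
  by rewrite big1 => [/esym/eqP|i _]; rewrite ?oner_eq0 // mxE mul0r.
exfalso; move: cS; rewrite compact_cover => /(_ V A (fun a => [set p | dot a p < 0])).
case=> [a _|p Sp|F FA cF].
- apply: (@open_comp _ _ (dot a) [set y | y < 0]); last exact: open_lt.
  by move=> x _; exact: continuous_dot.
- apply: contrapT => H; apply: nex; exists p; split=> // a Aa; rewrite leNgt dotC.
  by apply/negP => lt; apply: H; exists a.
have [|D [cD vD DA D0 FD]] := @finite_hull A (finmap.enum_fset F) a0 cA Aa0.
  by move=> x /FA; rewrite inE.
have [pr [prD prP]] := proj_exists cD vD D0.
pose p := pr 0; have Dp : D p by exact: prD.
have pA y : D y -> dot p p <= dot p y.
  move=> /(prP 0); rewrite -/p sub0r dotNl dotDr dotNr; lra.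
have pp : 0 < dot p p.
  rewrite lt_neqAle dot_ge0 andbT eq_sym; apply/eqP => pp0; apply: nA0.
  by rewrite -(dot_eq0 (u := p)) ?pp0 //; exact: DA.
pose c := (Num.sqrt (dot p p))^-1; have c0 : 0 < c by rewrite invr_gt0 sqrtr_gt0.
have : S (c *: p).
  split; first by apply: scalemx_sub; apply: AW; exact: DA.
  rewrite dotZl dotZr mulrA -expr2 /c exprVn sqr_sqrtr ?dot_ge0 // mulVf //.
  by rewrite gt_eqF.
move=> /cF[a /= aF]; rewrite dotZr dotC => lt.
have := pA a (FD a aF); apply/negP; rewrite -ltNge; apply: lt_trans pp.
by move: lt; rewrite pmulr_rlt0.
Qed.

(** Weak separation in a subspace of least dimension containing [A] is proper:
otherwise [A] would lie in the orthogonal of [p] within that subspace. *)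
Lemma proper_separation A : cvx A -> A !=set0 -> ~ A 0 ->
  exists p : V, (forall a, A a -> 0 <= dot p a) /\ exists2 a, A a & 0 < dot p a.
Proof.
move=> cA A0 nA0.
pose spans r := `[< exists W : 'M[R]_n, \rank W = r /\ forall a, A a -> (a <= W)%MS >].
have exr : exists r, spans r.
  exists (\rank (1%:M : 'M[R]_n)); apply/asboolP; exists 1%:M; split=> // a _.
  exact: submx1.
have [_ [W [<- AW]] Wmin] : exists2 r, (exists W : 'M[R]_n, \rank W = r /\
    forall a, A a -> (a <= W)%MS) & forall r', spans r' -> (r <= r')%N.
  by case: (ex_minnP exr) => r /asboolP Hr mr; exists r.
have [p [pW p0 pA]] := weak_separation cA A0 nA0 AW.
exists p; split=> //; apply: contrapT => nex.
pose W' := (W :&: kermx p^T)%MS.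
have dotE' (a : V) : a *m p^T = (dot p a)%:M.
  rewrite [LHS]mx11_scalar mxE; congr (_%:M).
  by apply: eq_bigr => i _; rewrite mxE mulrC.
have AW' a : A a -> (a <= W')%MS.
  move=> Aa; rewrite sub_capmx AW //=; apply/sub_kermxP; rewrite dotE'.
  suff -> : dot p a = 0 by rewrite raddf0.
  apply/eqP; rewrite eq_le pA // andbT leNgt; apply/negP => lt.
  by apply: nex; exists a.
have : (\rank W <= \rank W')%N by apply: Wmin; apply/asboolP; exists W'.
have W'W : (W' <= W)%MS by exact: capmxSl.
rewrite (geq_leqif (mxrank_leqif_sup W'W)) => WW'.
have := submx_trans pW WW'; rewrite sub_capmx pW => /sub_kermxP.
rewrite dotE' => /(congr1 (fun M : 'M[R]_1 => M 0 0)); rewrite !mxE eqxx mulr1n => pp.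
by move/eqP: p0; apply; apply: dot_eq0; rewrite pp.
Qed.

(** [l] is the mean of the [y m] with weights [2^-(m+1)], and [h k] its partial
sum, the remaining weight [2^-k] being given to [y 0].  A mean with positive
weights of a dense sequence of the closure of [A] belongs to [A]. *)
Lemma geometric_mean_mem A (y h : nat -> V) (l : V) (C : R) : cvx A -> A !=set0 ->
  (forall m e, 0 < e -> exists2 a, A a & `|y m - a| < e) ->
  (forall a e, A a -> 0 < e -> exists m, `|y m - a| < e) ->
  h 0%N = y 0%N ->
  (forall k, h k.+1 = h k + 2^-1 ^+ k.+1 *: (y k - y 0%N)) ->
  (forall k, `|l - h k| <= C * 2^-1 ^+ k) -> A l.
Proof.
move=> cA [b Ab] yA Ay h0 hS hl; apply: contrapT => nAl.
have [|||p [pA [c0 /= Ac0 pc0]]] := @proper_separation [set a | A (a + l)] _ _ (_ : ~ A (0 + l)).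
- move=> u v t /= Au Av t01.
  have -> : t *: u + (1 - t) *: v + l = t *: (u + l) + (1 - t) *: (v + l).
    by apply/rowP => i; rewrite !mxE; ring.
  exact: cA.
- by exists (b - l); rewrite /= subrK.
- by rewrite add0r.
pose K := \sum_i `|p 0 i|; have K0 : 0 <= K by apply: sumr_ge0.
have Kb v e : 0 < e -> `|v| < e / (K + 1) -> `|dot p v| < e.
  move=> e0; rewrite ltr_pdivlMr ?ltr_wpDl // => ve.
  have := dot_bound p v; rewrite -/K; have := normr_ge0 v; nra.
pose q m := dot p (y m - l).
have q0 m : 0 <= q m.
  rewrite leNgt; apply/negP => qm.
  have [|a Aa ya] := yA m (- q m / (K + 1)).
    by rewrite divr_gt0 ?oppr_gt0 // ltr_wpDl.
  have := Kb _ _ _ ya; rewrite oppr_gt0 => /(_ qm).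
  have := pA (a - l); rewrite /= subrK => /(_ Aa).
  rewrite ltr_norml /q => h1 /andP[h2 _]; move: h1 h2; rewrite /q !dotE; lra.
have [m qm] : exists m, 0 < q m.
  have [|m ym] := Ay _ (dot p c0 / (K + 1)) Ac0; first by rewrite divr_gt0 // ltr_wpDl.
  exists m; have := Kb _ _ pc0 ym; rewrite ltr_norml /q !dotE; lra.
pose c k := dot p (h k - l).
have cS k : c k.+1 = c k + 2^-1 ^+ k.+1 * (q k - q 0%N).
  by rewrite /c /q hS !dotE; ring.
have clow k : 2^-1 ^+ k * q 0%N <= c k.
  elim: k => [|k IH]; first by rewrite expr0 mul1r /c h0.
  have := mulr_ge0 (ltW (expV2_gt0 k.+1)) (q0 k).
  rewrite cS mulrBr exprS; lra.
have clow2 k : 2^-1 ^+ (m.+1 + k) * q 0%N + 2^-1 ^+ m.+1 * q m <= c (m.+1 + k)%N.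
  elim: k => [|k IH].
    rewrite addn0 cS mulrBr; have := clow m; rewrite exprS; lra.
  rewrite addnS cS mulrBr; have qk := q0 (m.+1 + k)%N.
  have := mulr_ge0 (ltW (expV2_gt0 (m.+1 + k).+1)) qk.
  move: IH; rewrite [2^-1 ^+ (m.+1 + k).+1]exprS; lra.
pose eta := 2^-1 ^+ m.+1 * q m.
have eta0 : 0 < eta by rewrite mulr_gt0 // expV2_gt0.
have [|k kP] := @exists_expV2_lt R C (eta / (K + 1)).
  by rewrite divr_gt0 // ltr_wpDl.
have C0 : 0 <= C by have := hl 0%N; rewrite expr0 mulr1; exact: le_trans.
have small : `|h (m.+1 + k)%N - l| < eta / (K + 1).
  rewrite distrC; apply: le_lt_trans (hl _) _; apply: le_lt_trans kP.
  rewrite ler_wpM2l // exprD ler_piMl ?exprn_ge0 //.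
  by rewrite exprn_ile1 //; lra.
have := Kb _ _ eta0 small; rewrite -/(c (m.+1 + k)%N) ltr_norml => /andP[_].
by apply/negP; rewrite -leNgt; apply: le_trans (clow2 k); rewrite lerDr mulr_ge0 //.
Qed.

Lemma rat_dense (y : V) e : 0 < e -> exists q : 'rV[rat]_n, `|map_mx ratr q - y| < e.
Proof.
move=> e0; have e20 : 0 < e / 2 by rewrite divr_gt0.
have /choice[q qP] (i : 'I_n) : exists q : rat, `|ratr q - y 0 i| <= e / 2.
  have [|q] := @rat_in_itvoo R (y 0 i) (y 0 i + e / 2); first by rewrite ltrDl.
  rewrite in_itv /= => /andP[h1 h2]; exists q; rewrite ler_norml; lra.
exists (\row_i q i); apply: (@le_lt_trans _ _ (e / 2)); last by lra.
by apply: rV_norm_le => [|i]; [exact: ltW|rewrite !mxE].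
Qed.

(** For each rational ball, [T] is cut down to that ball on a closed set of
points whose neighbours all have values meeting it; this keeps lower
semi-continuity.  The selections of these countably many maps are dense. *)
Lemma dense_selections D T : compact D -> lsc_on D T ->
  (forall x, D x -> cvx (T x)) -> (forall x, D x -> T x !=set0) ->
  exists g : nat -> V -> V, [/\ forall m, cont_on D (g m),
    forall m x, D x -> forall e, 0 < e -> exists2 y, T x y & `|g m x - y| < e &
    forall x, D x -> forall y e, T x y -> 0 < e -> exists m, `|g m x - y| < e].
Proof.
move=> cD lT cT T0.
(* A rational centre, and exponents for the radius of the ball and for that of
   the neighbourhood. *)
pose idx := ('rV[rat]_n * nat * nat)%type.
pose Q (i : idx) : V := map_mx ratr i.1.1.
pose F (i : idx) (x : V) := forall x', D x' -> `|x' - x| < 2^-1 ^+ i.2 ->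
  exists2 y, T x' y & `|y - Q i| < 2^-1 ^+ i.1.2.
pose Ti i x := [set y | T x y /\ (F i x -> `|y - Q i| < 2^-1 ^+ i.1.2)].
have lTi i : lsc_on D (Ti i).
  move=> x0 Dx0 y [Ty Fy] e e0.
  have [Fx0|] := pselect (F i x0).
    have cQ : cont_on D (fun=> Q i).
      by move=> x Dx e' e'0; exists 1 => // z _ _; rewrite subrr normr0.
    have [d d0 dP] := lsc_on_ball lT cQ Dx0 (conj Ty (Fy Fx0)) e0.
    exists d => // x Dx /(dP x Dx)[y' [Ty' Qy'] yy']; exists y' => //.
  move=> /existsNP[x' /not_implyP[Dx' /not_implyP[xx' nF]]].
  have [d d0 dP] := lT x0 Dx0 y Ty e e0.
  exists (Num.min d (2^-1 ^+ i.2 - `|x' - x0|)).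
    by rewrite lt_min d0 subr_gt0.
  move=> x Dx; rewrite lt_min => /andP[xd xr].
  have [y' Ty' yy'] := dP x Dx xd; exists y' => //; split=> // Fx.
  exfalso; apply: nF; apply: Fx => //.
  have := ler_normD (x' - x0) (x0 - x); rewrite subrKA (distrC x0); lra.
have cTi i x : D x -> cvx (Ti i x).
  move=> Dx u v t [Tu Fu] [Tv Fv] t01; split; first exact: cT.
  by move=> Fx; apply: (@cvx_ball R n) => //; [exact: Fu|exact: Fv].
have Ti0 i x : D x -> Ti i x !=set0.
  move=> Dx; have [Fx|nFx] := pselect (F i x).
    have [|y Ty yQ] := Fx x Dx; first by rewrite subrr normr0 expV2_gt0.
    by exists y.
  by have [y Ty] := T0 x Dx; exists y.
have /choice[G GP] (i : idx) : exists g : V -> V, cont_on D g /\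
    forall x, D x -> forall e, 0 < e -> exists2 y, Ti i x y & `|g x - y| < e.
  by have [g cg gP] := closed_selection cD (lTi i) (cTi i) (Ti0 i); exists g.
exists (fun m => G (odflt (0, 0%N, 0%N) (unpickle m))); split=> [m|m x Dx e e0|x Dx y e Ty e0].
- exact: (GP _).1.
- by have [y [Ty _] h] := (GP (odflt (0, 0%N, 0%N) (unpickle m))).2 x Dx e e0; exists y.
have e3 : 0 < e / 3 by rewrite divr_gt0.
have [k] := exists_expV2_lt 1 e3; rewrite mul1r => kP.
have [q qP] := rat_dense y (expV2_gt0 k).
have [|d d0 dP] := lT x Dx y Ty (2^-1 ^+ k - `|map_mx ratr q - y|).
  by rewrite subr_gt0.
have [j] := exists_expV2_lt 1 d0; rewrite mul1r => jP.
pose i : idx := (q, k, j); exists (pickle i); rewrite pickleK /=.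
have Fx : F i x.
  move=> x' Dx' xx'; have [|z Tz zy] := dP x' Dx'; first exact: lt_trans xx' jP.
  exists z => //; have := ler_normD (z - y) (y - map_mx ratr q).
  rewrite subrKA (distrC y) /Q /=; lra.
have [z [Tz zF] Gz] := (GP i).2 x Dx _ e3; have {}zF := zF Fx.
have -> : G i x - y = (G i x - z) + (z - Q i) + (Q i - y) by rewrite !subrKA.
have := ler_normD (G i x - z + (z - Q i)) (Q i - y).
have := ler_normD (G i x - z) (z - Q i).
rewrite /Q /= in zF *; lra.
Qed.

(** Michael's selection theorem in finite dimension.  The values need not be
closed; they are first cut down to unit balls around a selection of their
closure, so that the selections to be averaged are uniformly bounded. *)
Theorem michael_selection D T : compact D -> lsc_on D T ->
  (forall x, D x -> cvx (T x)) -> (forall x, D x -> T x !=set0) ->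
  exists2 g : V -> V, cont_on D g & forall x, D x -> T x (g x).
Proof.
move=> cD lT cT T0.
have [g0 cg0 g0P] := closed_selection cD lT cT T0.
pose T1 x := [set y | T x y /\ `|y - g0 x| < 1].
have T10 x : D x -> T1 x !=set0.
  by move=> Dx; have [y Ty h] := g0P x Dx 1 ltr01; exists y; split; rewrite // distrC.
have cT1 x : D x -> cvx (T1 x).
  by move=> Dx; apply: cvxI; [exact: cT|exact: cvx_ball].
have [g [cg gT gd]] := dense_selections cD (lsc_on_ball (r := 1) lT cg0) cT1 T10.
pose h := fix h k := if k is k'.+1 then
  (fun x => h k' x + 2^-1 ^+ k *: (g k' x - g 0%N x)) else g 0%N.
have gbound m x : D x -> `|g m x - g0 x| <= 2.
  move=> Dx; have [y [_ h1] h2] := gT m x Dx 1 ltr01.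
  have := ler_normD (g m x - y) (y - g0 x); rewrite subrKA; lra.
have [||k x Dx|l cl lP] := @geometric_limit R n D 4 h; first by [].
- elim=> [|k IH]; first exact: cg.
  apply: cont_onD => //; apply: cont_onZ; apply: cont_onD => //.
  rewrite (_ : (fun x => - g 0%N x) = fun x => -1 *: g 0%N x); first exact: cont_onZ.
  by apply/funext => x; rewrite scaleN1r.
- rewrite /= addrAC subrr add0r normrZ ger0_norm ?exprn_ge0 //.
  have h1 := gbound k x Dx; have h2 := gbound 0%N x Dx.
  have := ler_normD (g k x - g0 x) (g0 x - g 0%N x); rewrite subrKA (distrC (g0 x)) => h3.
  have h4 : `|g k x - g 0%N x| <= 4 by lra.
  have := expV2_gt0 k; rewrite exprS; nra.
exists l => // x Dx; suff [] : T1 x (l x) by [].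
apply: (@geometric_mean_mem (T1 x) (g^~ x) (h^~ x) (l x) (2 * 4)) => //.
- exact: cT1.
- exact: T10.
- by move=> m e; exact: gT.
- by move=> a e; exact: gd.
- by move=> k; exact: lP.
Qed.

End Michael.

(** * Convex hulls, balls and fixed points *)

Section FixedPoint.
Context {R : realType} {n : nat}.
Notation V := 'rV[R]_n.
Implicit Types (A C D X : set V) (T : V -> set V).

Lemma convex_set_cvx A : convex_set (A : set (convex_lmodType V)) -> cvx A.
Proof.
move=> cA x y t Ax Ay /andP[t0 t1].
have := cA x y (Itv01 t0 t1) (mem_set Ax) (mem_set Ay); rewrite inE.
by [].
Qed.

Lemma cvx_convex_set A : cvx A -> convex_set (A : set (convex_lmodType V)).
Proof.
move=> cA x y t; rewrite !inE => Ax Ay; apply: cA => //.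
by rewrite ge0 le1.
Qed.

Lemma cvx_convex_hull A : cvx (convex_hull A).
Proof.
move=> x y t hx hy t01 B [cB AB]; apply: (convex_set_cvx cB) => //; [exact: hx|exact: hy].
Qed.

Lemma sub_convex_hull A : A `<=` convex_hull A.
Proof. exact: sub_smallest. Qed.

Lemma convex_hull_min A B : cvx B -> A `<=` B -> convex_hull A `<=` B.
Proof. by move=> cB AB x; apply; split=> //; exact: cvx_convex_set. Qed.

Lemma convex_hullS A B : A `<=` B -> convex_hull A `<=` convex_hull B.
Proof.
move=> AB; apply: convex_hull_min; first exact: cvx_convex_hull.
exact: subset_trans AB (@sub_convex_hull B).
Qed.

Lemma convex_hull_finite A x : convex_hull A x ->
  exists (m : nat) (z : 'I_m.+1 -> V), (forall i, A (z i)) /\ convex_hull (range z) x.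
Proof.
move: x; apply: convex_hull_min => [x y t [k [u [uA ux]]] [m [v [vA vy]]] t01|x Ax]; last first.
  exists 0%N, (fun=> x); split=> //; apply: sub_convex_hull; by exists ord0.
exists (k + m.+1)%N, (fun i => match fintype.split (i : 'I_(k.+1 + m.+1)) with
  | inl i => u i | inr j => v j end); split.
  by move=> i; case: (fintype.split _).
apply: cvx_convex_hull => //.
- apply: convex_hullS ux => _ [i _ <-]; exists (lshift m.+1 i : 'I_(k.+1 + m.+1)) => //.
  by rewrite (unsplitK (inl i)).
- apply: convex_hullS vy => _ [i _ <-]; exists (rshift k.+1 i : 'I_(k.+1 + m.+1)) => //.
  by rewrite (unsplitK (inr i)).
Qed.

Lemma lsc_setmap_on X T : lsc_setmap (T : subspace X -> set V) -> lsc_on X T.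
Proof.
move=> lT x0 Xx0 y Ty e e0.
have ob : open (ball y e) by exact: ball_open.
have /(lT x0 _ ob) : T x0 `&` ball y e !=set0 by exists y; split=> //; exact: ballxx.
move=> H; have : within X (nbhs x0) [set x | T x `&` ball y e !=set0].
  by rewrite nbhs_subspace_in.
move=> /nbhs_normP[d d0 dP].
exists d => // x Xx xx0; have [|y' [Ty']] := dP x _ Xx; first by rewrite /= distrC.
by rewrite -ball_normE /= distrC => yy'; exists y'.
Qed.

Lemma lsc_on_convex_hull X T : lsc_on X T -> lsc_on X (fun x => convex_hull (T x)).
Proof.
move=> lT x0 Xx0; apply: convex_hull_min => [y z t Hy Hz /andP[t0 t1] e e0|y Ty e e0].
  have [d1 d10 d1P] := Hy e e0; have [d2 d20 d2P] := Hz e e0.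
  exists (Num.min d1 d2); first by rewrite lt_min d10.
  move=> x Xx; rewrite lt_min => /andP[/(d1P x Xx)[y' hy yy'] /(d2P x Xx)[z' hz zz']].
  exists (t *: y' + (1 - t) *: z'); first by apply: cvx_convex_hull; rewrite ?t0.
  have := @cvx_ball R n 0 e (y' - y) (z' - z) t; rewrite /= !subr0 => /(_ yy' zz').
  rewrite t0 t1 => /(_ isT); congr (`|_| < _).
  by apply/rowP => i; rewrite !mxE; ring.
have [d d0 dP] := lT x0 Xx0 y Ty e e0; exists d => // x Xx /(dP x Xx)[y' Ty' yy'].
by exists y' => //; exact: sub_convex_hull.
Qed.

Lemma near_dot_lt (y : V) r : dot y y < r ->
  exists2 d, 0 < d & forall z, `|z - y| < d -> dot z z < r.
Proof.
move=> yr; have /cont_on_at/(_ y I (r - dot y y)) :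
    forall x, [set: V] x -> (fun u : V => dot u u : R^o) x @[x --> x] --> dot x x.
  by move=> x _; exact: continuous_dot_self.
rewrite subr_gt0 => /(_ yr)[d d0 dP]; exists d => // z /(dP z I).
by rewrite ltr_norml => /andP[_]; rewrite ltrD2r.
Qed.

Lemma lsc_on_oball X T rho : 0 < rho -> lsc_on X T ->
  lsc_on X (fun x => [set y | T x y /\ enorm y < rho]).
Proof.
move=> rho0 lT x0 Xx0 y [Ty yr] e e0.
move: yr; rewrite (enorm_ltr _ (ltW rho0)) => /near_dot_lt[d d0 dP].
have m0 : 0 < Num.min d e by rewrite lt_min d0.
have [d' d'0 d'P] := lT x0 Xx0 y Ty _ m0; exists d' => // x Xx /(d'P x Xx)[y' Ty'].
rewrite lt_min => /andP[/dP yd ye]; exists y' => //; split=> //=.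
by rewrite (enorm_ltr _ (ltW rho0)).
Qed.

Lemma cvx_cball (rho : R) : 0 < rho -> cvx [set y : V | enorm y <= rho].
Proof.
move=> rho0 x y t /= hx hy t01; move: hx hy; rewrite !(enorm_ler _ (ltW rho0)) => hx hy.
apply: le_trans (dot_conv_le x y t01) _; move: t01 => /andP[t0 t1]; nra.
Qed.

Lemma dot_conv_lt (x y : V) t r : dot x x < r -> dot y y <= r -> 0 < t <= 1 ->
  dot (t *: x + (1 - t) *: y) (t *: x + (1 - t) *: y) < r.
Proof.
move=> hx hy /andP[t0 t1].
have t01 : 0 <= t <= 1 by rewrite ltW.
apply: le_lt_trans (dot_conv_le x y t01) _.
have h1 : t * dot x x < t * r by rewrite ltr_pM2l.
have h2 : (1 - t) * dot y y <= (1 - t) * r by rewrite ler_wpM2l // subr_ge0.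
lra.
Qed.

Lemma cvx_oball (rho : R) : 0 < rho -> cvx [set y : V | enorm y < rho].
Proof.
move=> rho0 x y t /= hx hy /andP[t0 t1].
have [->|tn] := eqVneq t 0; first by rewrite scale0r subr0 scale1r add0r.
move: hx hy; rewrite !(enorm_ltr _ (ltW rho0)) => hx hy; apply: dot_conv_lt => //.
  exact: ltW.
by rewrite lt_neqAle eq_sym tn t0.
Qed.

(** In terms of the squared norm: a segment starting inside a ball stays there
for a while. *)
Lemma segment_in_ball (x y : V) r : dot x x < r ->
  exists2 t, 0 < t < 1 & dot (t *: y + (1 - t) *: x) (t *: y + (1 - t) *: x) < r.
Proof.
move=> xr; pose s := r - dot x x; have s0 : 0 < s by rewrite subr_gt0.
have y0 := dot_ge0 y; have x0 := dot_ge0 x.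
have ys : 0 < 2 * (dot y y + s) by lra.
pose t := s / (2 * (dot y y + s)); have t0 : 0 < t by rewrite divr_gt0.
have tE : t * (2 * (dot y y + s)) = s by rewrite divfK // gt_eqF.
have t1 : t < 1 by rewrite ltr_pdivrMr // mul1r; lra.
exists t; first by rewrite t0.
have t01 : 0 <= t <= 1 by rewrite !ltW.
apply: le_lt_trans (dot_conv_le y x t01) _.
have ts : 0 < t * s by rewrite mulr_gt0.
have tx : 0 <= t * dot x x by rewrite mulr_ge0 // ltW.
have rE : r = s + dot x x by rewrite subrK.
rewrite rE; move: tE ts tx; clearbody t s; lra.
Qed.

(** At a point fixed by the selection [g] followed by the projection onto [D],
either [g x] is in the ball and is not moved, or [x] is on the sphere, as
[C] is convex, and [g x] is in the ball by hypothesis. *)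
Theorem lsc_fixed_point C T (rho : R) : closed C -> cvx C -> 0 < rho ->
  let D := [set x | C x /\ enorm x <= rho] in
  D !=set0 -> lsc_on D T -> (forall x, D x -> cvx (T x)) ->
  (forall x, D x -> T x !=set0) -> (forall x, D x -> T x `<=` C) ->
  (forall x, D x -> rho <= enorm x -> forall y, T x y -> enorm y <= rho) ->
  exists2 x, D x & T x x.
Proof.
move=> clC cC rho0 D D0 lT cT T0 TC Tb.
have cb : closed [set x : V | enorm x <= rho].
  have -> : [set x : V | enorm x <= rho] = (fun x => dot x x) @^-1` [set y | y <= rho ^+ 2].
    by apply/seteqP; split => x /=; rewrite (enorm_ler _ (ltW rho0)).
  apply: closed_comp; last exact: closed_le.
  by move=> x _; exact: continuous_dot_self.
have cD : compact D.
  apply: bounded_closed_compact; last exact: closedI.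
  exists rho; split; first exact: num_real.
  move=> M rM x [_ xr]; have M0 : 0 <= M by rewrite ltW // (lt_trans rho0).
  by apply: norm_le_dot => //; rewrite -enorm_ler // (le_trans xr) // ltW.
have vD : cvx D by apply: cvxI => //; exact: cvx_cball.
have [g cg gT] := michael_selection cD lT cT T0.
have [p [pD pP]] := proj_exists cD vD D0.
have [||x Dx xE] := @brouwer_compact_convex R n D (p \o g) cD vD D0.
- exact: comp_cont_on cg (proj_continuous pD pP).
- by move=> x _; exact: pD.
exists x => //; have Tg := gT x Dx.
have [gb|gb] := leP (enorm (g x)) rho.
  have Dg : D (g x) by split=> //; exact: TC Tg.
  by move: xE; rewrite /= (proj_id pP Dg) => e; rewrite -[X in T _ X]e.
have xb : dot x x < rho ^+ 2.
  rewrite -(enorm_ltr _ (ltW rho0)) ltNge; apply/negP => xb.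
  by have := Tb x Dx xb _ Tg; rewrite leNgt gb.
have [t /andP[t0 t1] tb] := segment_in_ball (g x) xb.
have Dt : D (t *: g x + (1 - t) *: x).
  split; last by rewrite (enorm_ler _ (ltW rho0)) ltW.
  by apply: cC; [exact: TC Tg|exact: Dx.1|rewrite !ltW].
have := pP (g x) _ Dt; rewrite -[p (g x)]/((p \o g) x) xE.
rewrite (_ : t *: g x + (1 - t) *: x - x = t *: (g x - x)); last first.
  by apply/rowP => i; rewrite !mxE; ring.
rewrite dotZr pmulr_rle0 // => /dot_eq0/eqP; rewrite subr_eq0 => /eqP e.
by rewrite -[X in T _ X]e.
Qed.

Lemma closed_not_near F (x0 : V) : closed F -> ~ F x0 ->
  exists2 d, 0 < d & forall x, `|x - x0| < d -> ~ F x.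
Proof.
move=> /closed_openC oF nF; have /nbhs_normP[d d0 dP] : nbhs x0 (~` F).
  exact: open_nbhs_nbhs.
by exists d => // x xd; apply: dP; rewrite /= distrC.
Qed.

End FixedPoint.

(** * Quasi-equilibria *)

Section QuasiEquilibrium.
Context {R : realType} {n : nat}.
Notation V := 'rV[R]_n.
Variables (f : V -> V -> R) (C : set V) (K : V -> set V) (rho : R).
Hypothesis C_closed : closed C.
Hypothesis C_cvx : cvx C.
Hypothesis C_neq0 : C !=set0.
Hypothesis K_C : forall x, C x -> K x `<=` C.
Hypothesis rho_gt0 : 0 < rho.
Hypothesis fK_UCC : UCC f C K rho.
Hypothesis K_lsc : lsc_on C K.
Hypothesis K_cvx : forall x, C x -> cvx (K x).
Hypothesis Fix_closed : closed (Fix C K).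
Hypothesis f_segment : forall x, Fix C K x -> forall y z,
  f x y <= 0 /\ f x z < 0 -> forall t : R, 0 < t < 1 -> f x (t *: y + (1 - t) *: z) < 0.

Let D : set V := [set x | C x /\ enorm x <= rho].
Let Koball x : set V := [set y | K x y /\ enorm y < rho].

Lemma truncation_neq0 : D !=set0.
Proof.
have [w Cw] := C_neq0; have [y [Kwy yr]] := fK_UCC.1 w Cw.
by exists y; split; [exact: K_C Kwy|exact: ltW].
Qed.

Lemma Koball_lsc : lsc_on C Koball. Proof. exact: lsc_on_oball. Qed.

Lemma Koball_cvx x : C x -> cvx (Koball x).
Proof. by move=> Cx; apply: cvxI; [exact: K_cvx|exact: cvx_oball]. Qed.

Lemma Koball_neq0 x : C x -> Koball x !=set0.
Proof. by move=> /(fK_UCC.1 x)[y [Ky yr]]; exists y. Qed.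

(** The property of segments for [f x], applied between [u] and [y]. *)
Lemma negative_in_oball x u y : Fix C K x -> K x u -> f x u <= 0 -> enorm u < rho ->
  K x y -> f x y < 0 -> exists z, [/\ K x z, f x z < 0 & enorm z < rho].
Proof.
move=> Fx Ku fu ur Ky fy.
move: ur; rewrite (enorm_ltr _ (ltW rho_gt0)) => /(segment_in_ball y)[t /andP[t0 t1] tr].
exists (t *: y + (1 - t) *: u); split; last by rewrite (enorm_ltr _ (ltW rho_gt0)).
  by apply: K_cvx => //; [exact: Fx.1|rewrite !ltW].
rewrite addrC -[t in t *: y](subKr 1); apply: f_segment => //.
by rewrite subr_gt0 t1 ltrBlDr ltrDl.
Qed.

(** The coercivity condition, at the point [x] itself. *)
Lemma boundary_nonpos x : Fix C K x -> enorm x = rho ->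
  exists u, [/\ K x u, f x u <= 0 & enorm u < rho].
Proof.
move=> Fx xr; have [rz /andP[rz0 rzr] H] := fK_UCC.2 x Fx.
have [|y [Ky yx fy]] := H x; last by exists y; split; rewrite // -xr.
split; first by split; [exact: Fx.2|rewrite /cball /= xr].
by rewrite /cball /= xr; apply/negP; rewrite -ltNge.
Qed.

(** When [f x x <= 0], it is enough to test the equilibrium inequality in the
closed ball. *)
Lemma qep_of_ball x : Fix C K x -> enorm x <= rho -> f x x <= 0 ->
  (forall y, K x y -> enorm y <= rho -> 0 <= f x y) -> QEP f C K x.
Proof.
move=> Fx xr fxx H; split; [exact: Fx.1|exact: Fx.2|move=> y Ky].
rewrite leNgt; apply/negP => fy.
have [u [Ku fu ur]] : exists u, [/\ K x u, f x u <= 0 & enorm u < rho].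
  move: xr; rewrite le_eqVlt => /orP[/eqP|] xr; first exact: boundary_nonpos.
  by exists x; split => //; exact: Fx.2.
have [z [Kz fz zr]] := negative_in_oball Fx Ku fu ur Ky fy.
by have := H z Kz (ltW zr); rewrite leNgt fz.
Qed.

(** The first alternative: the map [T] is the convex hull of [G x] on Fix(K), and
[K x] cut by the open ball outside Fix(K). *)
Theorem qep_quasimonotone : properly_quasimonotone f C -> upper_sign_property f C ->
  lsc_on (Fix C K) (Gmap f K rho) -> QEP f C K !=set0.
Proof.
move=> fq fu lG; apply: contrapT => nQ.
have fhull x (A : set V) : A `<=` C -> (forall y, A y -> 0 < f y x) -> ~ convex_hull A x.
  move=> AC Af /convex_hull_finite[m [z [zA zx]]].
  have := fq m z (fun i => AC _ (zA i)) x zx; rewrite leNgt => /negP; apply.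
  elim/big_ind: _ => [|a b a0 b0|i _]; try exact: Af.
  by rewrite lt_min a0.
have fxx x : C x -> f x x <= 0.
  move=> Cx; rewrite leNgt; apply/negP => fx.
  apply: (fhull x [set x]); [by move=> _ ->|by move=> _ ->|exact: sub_convex_hull].
have G_neq0 x : Fix C K x -> enorm x <= rho -> Gmap f K rho x !=set0.
  move=> Fx xr; apply: contrapT => G0; apply: nQ; exists x.
  apply: qep_of_ball => //; first exact: fxx Fx.1.
  move=> y Ky yr; apply: fu; [exact: Fx.1|exact: (K_C Fx.1)|move=> t /andP[t0 t1]].
  rewrite leNgt; apply/negP => ft; apply: G0; exists (t *: x + (1 - t) *: y).
  split=> //; split; first by apply: K_cvx; [exact: Fx.1|exact: Fx.2|by []|rewrite !ltW].
  by apply: cvx_cball; rewrite // !ltW.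
pose T x : set V := [set y | (Fix C K x /\ convex_hull (Gmap f K rho x) y) \/
                             (~ Fix C K x /\ Koball x y)].
have hullG x : Fix C K x -> convex_hull (Gmap f K rho x) `<=` K x `&` cball rho.
  move=> Fx; apply: convex_hull_min => [|y [] //].
  by apply: cvxI; [exact: K_cvx Fx.1|exact: cvx_cball].
have TF x : Fix C K x -> T x = convex_hull (Gmap f K rho x).
  by move=> Fx; apply/seteqP; split => y /=; [case=> -[]|left].
have TnF x : ~ Fix C K x -> T x = Koball x.
  by move=> Fx; apply/seteqP; split => y /=; [case=> -[]|right].
have [||||x Dx|x Dx Txx] := @lsc_fixed_point R n C T rho C_closed C_cvx rho_gt0 truncation_neq0.
- move=> x0 Dx0 y Ty e e0; have Cx0 := Dx0.1.
  have [Fx0|nFx0] := pselect (Fix C K x0); last first.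
    rewrite (TnF _ nFx0) in Ty.
    have [d1 d10 d1P] := closed_not_near Fix_closed nFx0.
    have [d2 d20 d2P] := Koball_lsc Cx0 Ty e0.
    exists (Num.min d1 d2); first by rewrite lt_min d10.
    move=> x [Cx _]; rewrite lt_min => /andP[/d1P nFx /(d2P x Cx)].
    by rewrite (TnF _ nFx).
  rewrite (TF _ Fx0) in Ty.
  have [d1 d10 d1P] := lsc_on_convex_hull lG Fx0 Ty e0.
  have [Ky yr] := hullG _ Fx0 _ Ty.
  (* [y] may be on the sphere; for points outside Fix(K) it is first moved
     slightly towards the point [w] inside the ball. *)
  have [w [Kw wr]] := Koball_neq0 Cx0.
  have [t /andP[t0 t1] tP] : exists2 t, 0 < t < 1 & t * `|w - y| < e / 2.
    exists (Num.min (1 / 2) (e / 2 / (`|w - y| + 1))).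
      have h1 : 0 < 1 / 2 :> R by lra.
      have h2 : 1 / 2 < 1 :> R by lra.
      by rewrite lt_min gt_min h1 h2 !divr_gt0 // ltr_wpDl.
    apply: le_lt_trans (_ : e / 2 / (`|w - y| + 1) * `|w - y| < _).
      by rewrite ler_wpM2r // ge_min lexx orbT.
    rewrite mulrAC ltr_pdivrMr ?ltr_wpDl // ltr_pM2l ?divr_gt0 // ltrDl //.
  have y1 : Koball x0 (t *: w + (1 - t) *: y).
    split; first by apply: K_cvx => //; rewrite !ltW.
    move: wr yr; rewrite /cball /= !(enorm_ltr _ (ltW rho_gt0)) (enorm_ler _ (ltW rho_gt0)).
    by move=> wr yr; apply: dot_conv_lt => //; rewrite t0 ltW.
  have e20 : 0 < e / 2 by rewrite divr_gt0.
  have [d2 d20 d2P] := Koball_lsc Cx0 y1 e20.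
  exists (Num.min d1 d2); first by rewrite lt_min d10.
  move=> x [Cx _]; rewrite lt_min => /andP[xd1 xd2].
  have [Fx|nFx] := pselect (Fix C K x); first by rewrite (TF _ Fx); exact: d1P.
  rewrite (TnF _ nFx); have [z Kz zy] := d2P x Cx xd2; exists z => //.
  have -> : z - y = (z - (t *: w + (1 - t) *: y)) + t *: (w - y).
    by apply/rowP => i; rewrite !mxE; ring.
  rewrite (le_lt_trans (ler_normD _ _)) // [ltRHS]splitr ltrD //.
  by rewrite normrZ gtr0_norm.
- move=> x [Cx _]; have [Fx|nFx] := pselect (Fix C K x).
    by rewrite (TF _ Fx); exact: cvx_convex_hull.
  by rewrite (TnF _ nFx); exact: Koball_cvx.
- move=> x [Cx xr]; have [Fx|nFx] := pselect (Fix C K x).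
    have [y Gy] := G_neq0 x Fx xr; exists y; rewrite (TF _ Fx).
    exact: sub_convex_hull.
  by rewrite (TnF _ nFx); exact: Koball_neq0.
- move=> x [Cx xr] y; have [Fx|nFx] := pselect (Fix C K x).
    by rewrite (TF _ Fx) => /(hullG _ Fx)[/(K_C Cx)].
  by rewrite (TnF _ nFx) => -[/(K_C Cx)].
- move=> _ y; have [Fx|nFx] := pselect (Fix C K x).
    by rewrite (TF _ Fx) => /(hullG _ Fx)[].
  by rewrite (TnF _ nFx) => -[_ /ltW].
have [Fx|nFx] := pselect (Fix C K x); last first.
  by move: Txx; rewrite (TnF _ nFx) => -[Kxx _]; apply: nFx; split=> //; exact: Dx.1.
move: Txx; rewrite (TF _ Fx); apply: fhull => [y [[Ky _] _]|y []//].
exact: K_C Fx.1 _ Ky.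
Qed.

(** The second alternative: [T0 x] is [R x] on Fix(K), and [K x] outside it.  It
is cut by the open ball only at the points [x] of the sphere, as elsewhere the
intersection of [R x] with the ball may be empty when [f x x > 0]. *)
Theorem qep_nonneg_diagonal : (forall x, Fix C K x -> 0 <= f x x) ->
  lsc_on (Fix C K) (Rmap f K) -> (forall x, Fix C K x -> cvx (Rmap f K x)) ->
  QEP f C K !=set0.
Proof.
move=> fxx lR cR; apply: contrapT => nQ.
pose T0 x : set V := [set y | (Fix C K x /\ Rmap f K x y) \/ (~ Fix C K x /\ K x y)].
have TF x : Fix C K x -> T0 x = Rmap f K x.
  by move=> Fx; apply/seteqP; split => y /=; [case=> -[]|left].
have TnF x : ~ Fix C K x -> T0 x = K x.
  by move=> Fx; apply/seteqP; split => y /=; [case=> -[]|right].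
have T0K x : T0 x `<=` K x.
  have [Fx|nFx] := pselect (Fix C K x); last by rewrite TnF.
  by rewrite TF // => y [].
have cT0 x : C x -> cvx (T0 x).
  move=> Cx; have [Fx|nFx] := pselect (Fix C K x); first by rewrite TF //; exact: cR.
  by rewrite TnF //; exact: K_cvx.
have lT0 : lsc_on C T0.
  move=> x0 Cx0 y Ty e e0; have [d1 d10 d1P] := K_lsc Cx0 (T0K _ _ Ty) e0.
  have [Fx0|nFx0] := pselect (Fix C K x0).
    rewrite (TF _ Fx0) in Ty; have [d2 d20 d2P] := lR x0 Fx0 y Ty e e0.
    exists (Num.min d1 d2); first by rewrite lt_min d10.
    move=> x Cx; rewrite lt_min => /andP[xd1 xd2].
    have [Fx|nFx] := pselect (Fix C K x); first by rewrite TF //; exact: d2P.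
    by rewrite TnF //; exact: d1P.
  have [d2 d20 d2P] := closed_not_near Fix_closed nFx0.
  exists (Num.min d1 d2); first by rewrite lt_min d10.
  by move=> x Cx; rewrite lt_min => /andP[xd1 /d2P nFx]; rewrite TnF //; exact: d1P.
pose T x : set V := [set y | T0 x y /\ (rho <= enorm x -> enorm y < rho)].
have Tb x : rho <= enorm x -> T x = [set y | T0 x y /\ enorm y < rho].
  by move=> xr; apply/seteqP; split => y /= [H1 H2]; split=> //; exact: H2.
have Ti x : enorm x < rho -> T x = T0 x.
  by rewrite ltNge => /negP xr; apply/seteqP; split => y /= => [[]//|H]; split.
have [||||x Dx|x Dx [Txx _]] := @lsc_fixed_point R n C T rho C_closed C_cvx rho_gt0 truncation_neq0.
- move=> x0 [Cx0 x0r] y Ty e e0.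
  have [xr|xr] := leP rho (enorm x0).
    have Ty' : T0 x0 y /\ enorm y < rho by move: Ty; rewrite Tb.
    have [d d0 dP] := lsc_on_oball rho_gt0 lT0 Cx0 Ty' e0.
    by exists d => // x [Cx _] /(dP x Cx)[z [Tz zr] zy]; exists z.
  have [d1 d10 d1P] := lT0 x0 Cx0 y Ty.1 e e0.
  move: xr; rewrite (enorm_ltr _ (ltW rho_gt0)) => /near_dot_lt[d2 d20 d2P].
  exists (Num.min d1 d2); first by rewrite lt_min d10.
  move=> x [Cx _]; rewrite lt_min => /andP[xd1 /d2P xd2].
  by rewrite Ti ?(enorm_ltr _ (ltW rho_gt0)) //; exact: d1P.
- move=> x [Cx _]; have [xr|xr] := leP rho (enorm x).
    by rewrite Tb //; apply: cvxI; [exact: cT0|exact: cvx_oball].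
  by rewrite Ti //; exact: cT0.
- move=> x [Cx xr].
  have [Fx|nFx] := pselect (Fix C K x); last first.
    have [y [Ky yr]] := Koball_neq0 Cx; exists y.
    by split=> //; rewrite TnF.
  have [y Ky fy] : exists2 y, K x y & f x y < 0.
    apply: contrapT => H; apply: nQ; exists x; split=> [//||y Ky]; first exact: Fx.2.
    by rewrite leNgt; apply/negP => fy; apply: H; exists y.
  move: xr; rewrite le_eqVlt => /orP[/eqP xr|xr].
    have [u [Ku fu ur]] := boundary_nonpos Fx xr.
    have [z [Kz fz zr]] := negative_in_oball Fx Ku fu ur Ky fy.
    by exists z; split=> //; rewrite TF.
  by exists y; rewrite Ti // TF.
- by move=> x [Cx _] y [/T0K/(K_C Cx)].
- by move=> xr y; rewrite Tb // => -[_ /ltW].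
have [Fx|nFx] := pselect (Fix C K x).
  by move: Txx; rewrite TF // => -[_]; rewrite ltNge fxx.
by move: Txx; rewrite TnF // => Kxx; apply: nFx; split=> //; exact: Dx.1.
Qed.

End QuasiEquilibrium.

Theorem theorem3p1 (R : realType) (n : nat)
    (f : 'rV[R]_n -> 'rV[R]_n -> R) (C : set 'rV[R]_n)
    (K : 'rV[R]_n -> set 'rV[R]_n) (rho : R)
    (C_neq0 : C !=set0)
    (C_convex : convex_set (C : set (convex_lmodType 'rV[R]_n)))
    (C_closed : closed C)
    (K_C : forall x, C x -> K x `<=` C)
    (rho_gt0 : 0 < rho)
    (fK_UCC : UCC f C K rho)
    (K_lsc : lsc_setmap (K : subspace C -> set 'rV[R]_n))
    (K_convex : forall x, C x ->
      convex_set (K x : set (convex_lmodType 'rV[R]_n)))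
    (K_neq0 : forall x, C x -> K x !=set0)
    (Fix_closed : closed (Fix C K))
    (f_segment : forall x, Fix C K x -> forall y z,
      f x y <= 0 /\ f x z < 0 ->
      forall t : R, 0 < t < 1 -> f x (t *: y + (1 - t) *: z) < 0) :
  [/\ properly_quasimonotone f C,
      upper_sign_property f C &
      lsc_setmap (Gmap f K rho : subspace (Fix C K) -> set 'rV[R]_n)]
  \/
  [/\ forall x, Fix C K x -> 0 <= f x x,
      lsc_setmap (Rmap f K : subspace (Fix C K) -> set 'rV[R]_n) &
      forall x, Fix C K x ->
        convex_set (Rmap f K x : set (convex_lmodType 'rV[R]_n))] ->
  QEP f C K !=set0.
Proof.
have C_cvx := convex_set_cvx C_convex.
have K_cvx x (Cx : C x) := convex_set_cvx (K_convex x Cx).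
have K_lsc' := lsc_setmap_on K_lsc.
case=> [[fq fu /lsc_setmap_on lG]|[fxx /lsc_setmap_on lR cR]].
  exact: (qep_quasimonotone C_closed C_cvx C_neq0 K_C rho_gt0 fK_UCC K_lsc').
apply: (qep_nonneg_diagonal C_closed C_cvx C_neq0 K_C rho_gt0 fK_UCC K_lsc') => //.
by move=> x Fx; apply: convex_set_cvx; exact: cR.
Qed.
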